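(* Let $p, n \ge 1$ be integers and let $p = p_S + p_C$ with integers $p_S \ge 1$, $p_C \ge 0$. Let $\mathbf{x} \in \mathbb{R}^{p}$ and $\mathbf{v} \in \mathbb{R}^{n}$ be zero-mean, mutually uncorrelated random vectors with covariance matrices $\mathbf{K}_{\mathbf{x}}$ and $\mathbf{K}_{\mathbf{v}}$, and let $\mathbf{A} \in \mathbb{R}^{n \times p}$ be a random matrix, independent of $(\mathbf{x},\mathbf{v})$, whose rows are i.i.d. $\mathcal{N}(0, I_p)$. The observations are $\mathbf{y} = \mathbf{A}\mathbf{x} + \mathbf{v}$. Fix a set of $p_S$ indices; let $\mathbf{x}_S \in \mathbb{R}^{p_S}$ be the subvector of $\mathbf{x}$ with these indices and $\mathbf{x}_C \in \mathbb{R}^{p_C}$ the subvector of the remaining entries, and let $\mathbf{A}_S \in \mathbb{R}^{n\times p_S}$, $\mathbf{A}_C \in \mathbb{R}^{n \times p_C}$ be the corresponding column submatrices of $\mathbf{A}$. Let $\mathbf{K}_{\mathbf{x}_S}$, $\mathbf{K}_{\mathbf{x}_C}$ be the covariance matrices of $\mathbf{x}_S$, $\mathbf{x}_C$. Consider the partial (mismatched) LMMSE estimator $$\mathbf{W}_S = \hat{\mathbf{K}}_{\mathbf{x}_S}\mathbf{A}_S^{\mathrm T}\big(\mathbf{A}_S \hat{\mathbf{K}}_{\mathbf{x}_S}\mathbf{A}_S^{\mathrm T} + \hat{\mathbf{K}}_{\mathbf{z}}\big)^{+}$$ with assumed covariances $\hat{\mathbf{K}}_{\mathbf{x}_S} =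 I_{p_S}$ and $\hat{\mathbf{K}}_{\mathbf{z}} = 0$, and define the expected MSE $$\varepsilon_S(p_S,n) = \mathbb{E}_{\mathbf{A}}\Big[\,\mathbb{E}_{\mathbf{x},\mathbf{v}}\big[\|\mathbf{x}_S - \mathbf{W}_S\mathbf{y}\|^2\big]\Big].$$ Then $$\varepsilon_S(p_S,n) = \operatorname{tr}(\mathbf{K}_{\mathbf{x}_S})\Big(1 - \frac{\min\{p_S,n\}}{p_S}\Big) + \gamma\Big(\operatorname{tr}(\mathbf{K}_{\mathbf{x}_C}) + \frac{1}{n}\operatorname{tr}(\mathbf{K}_{\mathbf{v}})\Big),$$ where $\gamma = \frac{p_S}{n-p_S-1}$ if $p_S < n-1$, $\gamma = \frac{n}{p_S - n - 1}$ if $p_S > n+1$, and $\gamma = +\infty$ otherwise.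
   Context: $\mathbf{M}^{+}$ denotes the Moore–Penrose pseudoinverse and $\mathbf{M}^{\mathrm T}$ the transpose; $\|\cdot\|$ is the Euclidean norm. The estimate of $\mathbf{x}_S$ is $\hat{\mathbf{x}}_S = \mathbf{W}_S\mathbf{y}$, which is computed assuming (incorrectly) the model $\mathbf{y} = \mathbf{A}_S\mathbf{x}_S + \mathbf{z}$, while $\mathbf{y}$ is actually generated by $\mathbf{y} = \mathbf{A}\mathbf{x}+\mathbf{v}$. The inner expectation is over $(\mathbf{x},\mathbf{v})$ for fixed $\mathbf{A}$, and the outer expectation is over $\mathbf{A}$. *)

(* Defs.v *)
From HB Require Import structures.
From mathcomp Require Import all_boot all_order all_algebra.
From mathcomp Require Import all_classical all_reals all_analysis.
Set Implicit Arguments. Unset Strict Implicit. Unset Printing Implicit Defensive.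
Import Order.TTheory GRing.Theory Num.Theory.
Local Open Scope classical_set_scope.
Local Open Scope ring_scope.

Definition mp_pinv_spec {R : realType} m n (M : 'M[R]_(m, n)) (X : 'M[R]_(n, m)) : Prop :=
  [/\ M *m X *m M = M, X *m M *m X = X,
      (M *m X)^T = M *m X & (X *m M)^T = X *m M].

(* The (unique, always existing) matrix satisfying the Penrose conditions. *)
Definition mp_pinv {R : realType} m n (M : 'M[R]_(m, n)) : 'M[R]_(n, m) :=
  xget 0 [set X | mp_pinv_spec M X].

Definition idxS p (S : {set 'I_p}) : 'I_#|S| -> 'I_p := enum_val (A := S).
Definition idxC p (S : {set 'I_p}) : 'I_#|~: S| -> 'I_p := enum_val (A := ~: S).

Definition subvecS {R : Type} p (S : {set 'I_p}) (x : 'cV[R]_p) : 'cV[R]_#|S| :=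
  rowsub (@idxS p S) x.
Definition colsubS {R : Type} n p (S : {set 'I_p}) (A : 'M[R]_(n, p)) : 'M[R]_(n, #|S|) :=
  colsub (@idxS p S) A.
Definition covS {R : Type} p (S : {set 'I_p}) (K : 'M[R]_p) : 'M[R]_#|S| :=
  mxsub (@idxS p S) (@idxS p S) K.
Definition covC {R : Type} p (S : {set 'I_p}) (K : 'M[R]_p) : 'M[R]_#|~: S| :=
  mxsub (@idxC p S) (@idxC p S) K.

Definition sqnorm {R : realType} k (e : 'cV[R]_k) : R := \sum_(i < k) e i 0 ^+ 2.

(* Partial mismatched LMMSE estimator with assumed K_xS = I and K_z = 0:
   W_S = I A_S^T (A_S I A_S^T + 0)^+ *)
Definition W_S {R : realType} n p (S : {set 'I_p}) (A : 'M[R]_(n, p)) : 'M[R]_(#|S|, n) :=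
  let AS := colsubS S A in
  (1%:M *m AS^T) *m mp_pinv (AS *m 1%:M *m AS^T + 0).

Definition zero_mean_uncorrelated {R : realType} {d} {T : measurableType d}
  (P : probability T R) p n (x : T -> 'cV[R]_p) (v : T -> 'cV[R]_n)
  (Kx : 'M[R]_p) (Kv : 'M[R]_n) : Prop :=
  [/\ (forall i, measurable_fun setT (fun t => x t i 0)),
      (forall i, measurable_fun setT (fun t => v t i 0)),
      (forall i, P.-integrable setT (fun t => ((x t i 0) ^+ 2)%:E)) &
      (forall i, P.-integrable setT (fun t => ((v t i 0) ^+ 2)%:E))] /\
  [/\ (forall i, (\int[P]_t (x t i 0)%:E = 0)%E),
      (forall i, (\int[P]_t (v t i 0)%:E = 0)%E),
      (forall i j, (\int[P]_t (x t i 0 * x t j 0)%:E = (Kx i j)%:E)%E),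
      (forall i j, (\int[P]_t (v t i 0 * v t j 0)%:E = (Kv i j)%:E)%E) &
      (forall i j, (\int[P]_t (x t i 0 * v t j 0)%:E = 0)%E)].

(* A : Omega' -> R^{n x p} has mutually independent N(0,1) entries
   (equivalently: i.i.d. rows distributed as N(0, I_p)). *)
Definition iid_std_gaussian_mx {R : realType} {d} {T : measurableType d}
  (Q : probability T R) n p (A : T -> 'M[R]_(n, p)) : Prop :=
  [/\ (forall i j, measurable_fun setT (fun w => A w i j)),
      (forall i j (B : set R), measurable B ->
          Q [set w | B (A w i j)] = normal_prob 0 1 B) &
      (forall B : 'I_n -> 'I_p -> set R, (forall i j, measurable (B i j)) ->
          Q [set w | forall i j, B i j (A w i j)] =
          (\prod_(i < n) \prod_(j < p) Q [set w | B i j (A w i j)])%E)].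

Definition gammaS {R : realType} (pS n : nat) : \bar R :=
  if (pS.+1 < n)%N then (pS%:R / (n%:R - pS%:R - 1))%:E
  else if (n.+1 < pS)%N then (n%:R / (pS%:R - n%:R - 1))%:E
  else +oo%E.

(* Main.v *)
Require Import Defs.
From HB Require Import structures.
From mathcomp Require Import all_boot all_order all_algebra all_fingroup.
From mathcomp Require Import all_classical all_reals all_analysis.
From mathcomp Require Import measurable_realfun ring lra.
Import Order.TTheory GRing.Theory Num.Theory.
Import numFieldNormedType.Exports.
Local Open Scope classical_set_scope.
Local Open Scope ring_scope.

(** The error is the sum of a quadratic form of [Kx] in the error matrix
    [(1 | 0) - W A] and one of [Kv] in [W].  The law of a Gaussian matrix is invariant
    under sign flips and permutations of its entries: averaging over the flips removes
    the off-diagonal entries of [Kx] and [Kv], the permutations equalize the columns,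
    and resampling the entries of [A] outside [S] reduces everything to
    [E |W|^2 = E (tr (B^T B)^-1)], where [B] is [A_S] or its transpose, whichever has
    full column rank, say of size [n x m].  For this last expectation put
    [G = B^T B + e], [t = tr G^-1]; Stein's identity applied to each entry of [B G^-1]
    gives [E (m - e t) = E ((n - m - 1) t + e |G^-1|^2 + e t^2)], all terms being
    bounded.  When [t] at [e = 0] is integrable, [e -> 0] yields
    [m = (n - m - 1) E t], which is absurd for [n <= m + 1]; when [n > m + 1],
    integrability follows from the same identity and Fatou's lemma. *)

Set Implicit Arguments. Unset Strict Implicit. Unset Printing Implicit Defensive.

(** * Gaussian matrices *)

Section gaussian_law.
Variable R : realType.
Local Notation N01 := (normal_prob (0 : R) 1).

(** The value [+oo] shapes the argument. The off-diagonal products in the quadratic forms have no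
    sign and may fail to be integrable, so they cannot be cancelled one at a time: the whole form,
    nonnegative because [Kx] and [Kv] are second-moment matrices, is averaged over the sign flips.
    The reduction thus takes place in [0, +oo], and the finite and infinite regimes are treated
    together. The regularization has the same origin: for e > 0 the inverse of [B^T B + e] is
    bounded and differentiable in each entry, whereas at e = 0 the integrability that Stein's
    identity would require is part of what has to be proved. Singular matrices form a null set; off
    it [mp_pinv] is exchanged for an explicit formula that is measurable and compatible with
    orthogonal changes of basis on all matrices. *)

Definition mx_box n p (B : 'I_n * 'I_p -> set R) : set 'M[R]_(n, p) :=
  [set M | forall k, B k (M k.1 k.2)].

Definition mx_boxes n p : set (set 'M[R]_(n, p)) :=
  [set mx_box B | B in [set B | forall k, measurable (B k)]].

Definition mxT n p := g_sigma_algebraType (@mx_boxes n p).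

Lemma mx_boxesI n p : setI_closed (@mx_boxes n p).
Proof.
move=> _ _ [B mB <-] [C mC <-]; exists (fun k => B k `&` C k) => /=.
  by move=> k; apply: measurableI.
apply/seteqP; split => M /=; first by move=> BC; split => k; case: (BC k).
by move=> [MB MC] k; split; [exact: MB | exact: MC].
Qed.

Lemma mx_boxesT n p : mx_boxes (setT : set 'M[R]_(n, p)).
Proof. by exists (fun=> setT) => //=; apply/seteqP; split. Qed.

Lemma measurable_entry n p i j :
  measurable_fun setT (fun M : mxT n p => M i j).
Proof.
move=> _ Y mY; rewrite setTI; apply: sub_sigma_algebra.
exists (fun k => if k == (i, j) then Y else setT) => /=.
  by move=> k; case: ifP.
apply/seteqP; split => M /=.
  by move=> /(_ (i, j)); rewrite eqxx.
by move=> YM k; case: ifP => // /eqP ->.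
Qed.

(* Box probabilities form a pi-system, so they determine the law of [A] on [mxT n p]. *)
Definition gauss_mx d (T : measurableType d) (Q : probability T R) n p
    (A : T -> 'M[R]_(n, p)) : Prop :=
  (forall i j, measurable_fun setT (fun w => A w i j)) /\
  (forall B : 'I_n * 'I_p -> set R, (forall k, measurable (B k)) ->
     Q [set w | forall k, B k (A w k.1 k.2)] = (\prod_k N01 (B k))%E).

Lemma gauss_mx_iid d (T : measurableType d) (Q : probability T R) n p
    (A : T -> 'M[R]_(n, p)) : iid_std_gaussian_mx Q A -> gauss_mx Q A.
Proof.
move=> [mA lawA indA]; split=> // B mB.
rewrite (eq_bigr (fun k => N01 (B (k.1, k.2)))); last by case.
rewrite -(pair_bigA _ (fun i j => N01 (B (i, j))))%E /=.
have -> : [set w | forall k, B k (A w k.1 k.2)] =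
    [set w | forall i j, B (i, j) (A w i j)].
  apply/seteqP; split => w /=; first by move=> H i j; exact: (H (i, j)).
  by move=> H [i j]; exact: H.
rewrite (indA (fun i j => B (i, j))) //.
by apply: eq_bigr => i _; apply: eq_bigr => j _; rewrite lawA.
Qed.

Section mx_rv.
Context d (T : measurableType d).

Lemma measurable_mxP n p (A : T -> 'M[R]_(n, p)) :
  (forall i j, measurable_fun setT (fun w => A w i j)) ->
  measurable_fun setT (A : T -> mxT n p).
Proof.
move=> mA; apply: (@measurability _ _ T (mxT n p) setT A (@mx_boxes n p)) => // _ [_ [B mB <-] <-].
rewrite setTI.
have -> : A @^-1` mx_box B =
    \big[setI/setT]_k ((fun w => A w k.1 k.2) @^-1` B k).
  rewrite -bigcap_seq; apply/seteqP; split => w /=.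
    by move=> H k _; exact: H.
  by move=> H k; apply: H => /=; rewrite mem_index_enum.
apply: bigsetI_measurable => k _.
by rewrite -[_ @^-1` _]setTI; apply: mA.
Qed.

End mx_rv.

(** The two matrices may live on different probability spaces; this allows a comparison with a
    matrix on a product space that carries one extra independent entry. *)
Lemma gauss_mx_law d1 (T1 : measurableType d1) (Q1 : probability T1 R)
    d2 (T2 : measurableType d2) (Q2 : probability T2 R) n p
    (A1 : T1 -> 'M[R]_(n, p)) (A2 : T2 -> 'M[R]_(n, p)) (F : mxT n p -> \bar R) :
  gauss_mx Q1 A1 -> gauss_mx Q2 A2 ->
  measurable_fun setT F -> (forall M, 0 <= F M)%E ->
  (\int[Q1]_w F (A1 w) = \int[Q2]_w F (A2 w))%E.
Proof.
move=> [mA1 lA1] [mA2 lA2] mF F0.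
have m1 := measurable_mxP mA1; have m2 := measurable_mxP mA2.
rewrite -[LHS](ge0_integral_pushforward m1 Q1 measurableT mF); last by move=> *.
rewrite -[RHS](ge0_integral_pushforward m2 Q2 measurableT mF); last by move=> *.
apply: eq_measure_integral => X mX _.
set P1 := (X in X _ = _); set P2 := (X in _ = X _).
apply: (@measure_unique _ R (mxT n p) (@mx_boxes n p) (fun=> setT) _ _ _ _ P1 P2) => //.
- exact: mx_boxesI.
- by move=> _; exact: mx_boxesT.
- by rewrite bigcup_const.
- by move=> _ [B mB <-]; exact: etrans (lA1 B mB) (esym (lA2 B mB)).
- by move=> _; rewrite (le_lt_trans (probability_le1 Q1 measurableT)) ?ltry.
Qed.

Lemma gauss_mx_reindex d (T : measurableType d) (Q : probability T R) n p m q
    (A : T -> 'M[R]_(n, p)) (f : 'I_m * 'I_q -> 'I_n * 'I_p) :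
  injective f -> gauss_mx Q A ->
  gauss_mx Q (fun w => \matrix_(i, j) A w (f (i, j)).1 (f (i, j)).2).
Proof.
move=> f_inj [mA lA]; split=> [i j|B mB].
  by under eq_fun do rewrite mxE; exact: mA.
(* [B'] transports [B] along [f] and leaves the entries outside the image unconstrained, so that
   their factor in the product is 1. *)
pose B' k : set R := if [pick l | f l == k] is Some l then B l else setT.
have B'f l : B' (f l) = B l.
  by rewrite /B'; case: pickP => [l' /eqP/f_inj -> //|/(_ l)]; rewrite eqxx.
have mB' k : measurable (B' k) by rewrite /B'; case: pickP.
transitivity (\prod_k N01 (B' k))%E; last first.
  rewrite (bigID (fun k => isSome [pick l | f l == k])) /= [X in (_ * X)%E]big1 ?mule1.
    rewrite (reindex_omap f (fun k => [pick l | f l == k])) => [|k].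
      apply: eq_big => [l|l _]; last by rewrite B'f.
      by case: pickP => [l' /eqP/f_inj ->|/(_ l)]; rewrite eqxx.
    by case: pickP => // l /eqP <-.
  move=> k; rewrite /B'; case: pickP => // _ _.
  exact: probability_setT.
rewrite -(lA B' mB'); congr (Q _); apply/seteqP; split => w /=.
  move=> H k; rewrite /B'; case: pickP => // -[i j] /eqP <-.
  by have := H (i, j); rewrite mxE.
by move=> H [i j]; rewrite mxE -B'f; exact: H.
Qed.

Lemma N01_opp (B : set R) : measurable B -> N01 (-%R @^-1` B) = N01 B.
Proof.
move=> mB; rewrite /normal_prob.
have mpdf : measurable_fun setT (fun x : R => (normal_pdf 0 1 x)%:E).
  by apply/measurable_EFinP; exact: measurable_normal_pdf.
transitivity (\int[lebesgue_measure]_(x in (-%R : R -> measurableTypeR R) @^-1` B)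
    ((fun x => (normal_pdf (0 : R) 1 x)%:E) \o (-%R : R -> measurableTypeR R)) x)%E.
  apply: eq_integral => x _ /=; congr EFin.
  by rewrite /normal_pdf oner_eq0 /normal_fun !subr0 sqrrN.
rewrite -ge0_integral_pushforward//=.
- by apply: eq_measure_integral => //= X mX _; exact: lebesgue_measureN.
- exact: measurable_funTS.
- by move=> x _; rewrite lee_fin normal_pdf_ge0.
Qed.

Lemma gauss_mx_sign d (T : measurableType d) (Q : probability T R) n p
    (A : T -> 'M[R]_(n, p)) (s : 'I_n * 'I_p -> bool) : gauss_mx Q A ->
  gauss_mx Q (fun w => \matrix_(i, j) ((-1) ^+ s (i, j) * A w i j)).
Proof.
move=> [mA lA]; split=> [i j|B mB].
  by under eq_fun do rewrite mxE; apply: measurable_funM.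
pose B' k : set R := if s k then -%R @^-1` B k else B k.
have mB' k : measurable (B' k).
  rewrite /B'; case: ifP => // _; rewrite -[_ @^-1` _]setTI.
  exact: oppr_measurable.
transitivity (\prod_k N01 (B' k))%E; last first.
  by apply: eq_bigr => k _; rewrite /B'; case: ifP => // _; rewrite N01_opp.
rewrite -(lA B' mB'); congr (Q _); apply/seteqP; split => w /= H [i j];
  have := H (i, j); rewrite /B' mxE /=;
  by case: (s _); rewrite /= ?expr1 ?expr0 ?mulN1r ?mul1r.
Qed.

Definition mx_upd n p (k : 'I_n * 'I_p) (M : 'M[R]_(n, p)) (z : R) :=
  \matrix_(i, j) (if (i, j) == k then z else M i j).

Lemma gauss_mx_upd d (T : measurableType d) (Q : probability T R) n p
    (A : T -> 'M[R]_(n, p)) (k : 'I_n * 'I_p) : gauss_mx Q A ->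
  gauss_mx (Q \x N01)%E (fun w => mx_upd k (A w.1) w.2).
Proof.
move=> [mA lA]; split=> [i j|B mB].
  under eq_fun do rewrite mxE.
  case: eqP => _; first exact: measurable_snd.
  exact: (measurableT_comp (mA i j) measurable_fst).
pose B' l : set R := if l == k then setT else B l.
have mB' l : measurable (B' l) by rewrite /B'; case: ifP.
have -> : [set w | forall l, B l (mx_upd k (A w.1) w.2 l.1 l.2)] =
    [set w | forall l, B' l (A w l.1 l.2)] `*` B k.
  apply/seteqP; split => -[w z] /=.
    move=> H; split => [[i j]|]; last first.
      by have := H k; rewrite mxE -surjective_pairing eqxx.
    by have := H (i, j); rewrite mxE /B' /=; case: eqP.
  move=> [H zk] [i j]; rewrite mxE /=; case: eqP => [-> //|ne].
  by have := H (i, j); rewrite /B'; case: eqP.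
transitivity (Q [set w | forall l, B' l (A w l.1 l.2)] * N01 (B k))%E.
  apply: product_measure1E; last exact: mB.
  rewrite (_ : [set w | _] = \big[setI/setT]_l ((fun w => A w l.1 l.2) @^-1` B' l)).
    apply: bigsetI_measurable => l _.
    by rewrite -[_ @^-1` _]setTI; apply: mA.
  rewrite -bigcap_seq; apply/seteqP; split => w /=.
    by move=> H l _; exact: H.
  by move=> H l; apply: H => /=; rewrite mem_index_enum.
transitivity ((\prod_l N01 (B' l)) * N01 (B k))%E; first by congr (_ * _)%E; exact: lA.
rewrite (bigD1 k) //= [RHS](bigD1 k) //= /B' eqxx probability_setT mul1e muleC.
congr (_ * _)%E; apply: eq_bigr => l lk; by rewrite (negbTE lk).
Qed.

(** This plays the part of conditioning on all entries but [k]: overwriting that entry by an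
    independent normal variable keeps the law, and Tonelli integrates the new variable first. *)
Lemma gauss_mx_resample d (T : measurableType d) (Q : probability T R) n p
    (A : T -> 'M[R]_(n, p)) (k : 'I_n * 'I_p) (F : mxT n p -> \bar R) :
  gauss_mx Q A -> measurable_fun setT F -> (forall M, 0 <= F M)%E ->
  (\int[Q]_w F (A w) = \int[Q]_w \int[N01]_z F (mx_upd k (A w) z))%E.
Proof.
move=> gA mF F0.
rewrite (gauss_mx_law gA (gauss_mx_upd k gA) mF F0).
apply: (@fubini_tonelli1 _ _ _ _ R Q N01 (fun wz => F (mx_upd k (A wz.1) wz.2))) => //.
apply: (measurableT_comp mF); apply: measurable_mxP.
by have [] := gauss_mx_upd k gA.
Qed.

End gaussian_law.

(** * Stein's identity in one variable *)

Section gaussian_1d.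
Variable R : realType.
Local Notation N01 := (normal_prob (0 : R) 1).
Local Notation phi := (normal_pdf (0 : R) 1).
Local Notation mu := (@lebesgue_measure R).

Lemma phiE x : phi x = normal_peak (1 : R) * expR (- x ^+ 2 / 2).
Proof.
by rewrite normal_pdfE ?oner_eq0 // /normal_fun subr0 expr1n.
Qed.

Lemma measurable_phi : measurable_fun setT phi.
Proof. exact: measurable_normal_pdf. Qed.

Lemma is_derive_phi (x : R) : is_derive x 1 phi (- x * phi x).
Proof.
have -> : phi = (fun x => normal_peak (1 : R) * expR (- x ^+ 2 / 2)).
  by apply/funext => y; exact: phiE.
pose g (y : R) := - y ^+ 2 / 2.
have dg : is_derive x 1 g (- x).
  apply: is_derive_eq; rewrite /= /GRing.scale /= ?mulr0 ?add0r ?addr0.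
  by field.
have dexp := is_derive1_comp (is_derive_expR (g x)) dg.
apply: (is_derive_eq (is_deriveZ (normal_peak (1:R)) dexp)).
by rewrite /GRing.scale /= /g; ring.
Qed.

Import HBNNSimple.

(** [normal_prob] has its density by definition on sets; simple functions carry this to integrals,
    and monotone convergence does the rest. *)
Lemma integral_N01_nnsfun (f : {nnsfun R >-> R}) :
  (\int[N01]_x (f x)%:E = \int[mu]_x ((f x)%:E * (phi x)%:E))%E.
Proof.
have mphi : measurable_fun setT (EFin \o phi).
  by apply/measurable_EFinP; exact: measurable_phi.
have mf1 r : measurable_fun setT (fun x => (r * \1_(f @^-1` [set r]) x)%:E).
  apply/measurable_EFinP; apply: measurable_funM => //.
under [LHS]eq_integral do rewrite fimfunE -fsumEFin//.
rewrite [LHS]ge0_integral_fsum//; last first.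
  - by move=> n x _; rewrite EFinM nnfun_muleindic_ge0.
under [RHS]eq_integral.
  move=> x xD; rewrite fimfunE -fsumEFin// muleC ge0_mule_fsumr; last first.
    by move=> r; rewrite EFinM nnfun_muleindic_ge0.
  over.
rewrite [RHS]ge0_integral_fsum//; last 2 first.
  - by move=> r; apply: emeasurable_funM; [exact: mphi | exact: mf1].
  - move=> n x _; rewrite mule_ge0// ?lee_fin ?normal_pdf_ge0 //.
    by rewrite -lee_fin EFinM nnfun_muleindic_ge0.
apply: eq_fsbigr => r _.
have [r0|r0] := ltP r 0.
  rewrite preimage_nnfun0 // !integral0_eq // => x _; by rewrite indic0 mulr0 ?mule0.
have mr : measurable (f @^-1` [set r]) by exact: (measurable_funPTI f).
have m1 : measurable_fun setT (fun x => (\1_(f @^-1` [set r]) x : R)%:E).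
  exact/measurable_EFinP/measurable_indic.
transitivity (r%:E * \int[N01]_x (\1_(f @^-1` [set r]) x)%:E)%E.
  by under eq_integral do rewrite EFinM; rewrite ge0_integralZl // => x _; rewrite lee_fin.
under [RHS]eq_integral do rewrite EFinM muleCA.
rewrite ge0_integralZl //.
- congr (_ * _)%E; rewrite integral_indic // setIT.
  rewrite -[LHS]/(normal_prob 0 1 (f @^-1` [set r])) /normal_prob [LHS]integral_mkcond; apply: eq_integral => x _.
  by rewrite patchE indicE; case: ifP; rewrite ?mule1 ?mule0.
- by apply: emeasurable_funM; [exact: mphi | exact: m1].
- by move=> x _; rewrite mule_ge0 // lee_fin ?normal_pdf_ge0.
Qed.

Lemma ge0_integral_N01 (f : R -> \bar R) :
  measurable_fun setT f -> (forall x, 0 <= f x)%E ->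
  (\int[N01]_x f x = \int[mu]_x (f x * (phi x)%:E))%E.
Proof.
move=> mf f0.
pose f_ := nnsfun_approx measurableT mf.
have cvgf x : ((f_ n x)%:E @[n --> \oo] --> f x)%E.
  exact: (cvg_nnsfun_approx measurableT mf (fun x _ => f0 x)).
transitivity (lim (\int[N01]_x (f_ n x)%:E @[n --> \oo])%E).
  rewrite -monotone_convergence//=.
  - by apply: eq_integral => x _; apply/esym/cvg_lim.
  - by move=> n; apply/measurable_EFinP; exact: (measurable_funP (f_ n)).
  - by move=> n ? _; rewrite lee_fin.
  - by move=> x _ ? ? mn; rewrite lee_fin; have /lefP/(_ x) := nd_nnsfun_approx measurableT mf mn.
transitivity (lim (\int[mu]_x ((f_ n x)%:E * (phi x)%:E) @[n --> \oo])%E); last first.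
  rewrite -monotone_convergence//=.
  - apply: eq_integral => x _; apply/cvg_lim => //.
    by apply: cvgeZr.
  - move=> n; apply: emeasurable_funM; apply/measurable_EFinP.
      exact: (measurable_funP (f_ n)).
    exact: measurable_phi.
  - by move=> n ? _; rewrite mule_ge0 // lee_fin // normal_pdf_ge0.
  - move=> x _ ? ? mn; rewrite lee_pmul // ?lee_fin // ?normal_pdf_ge0 //.
    by have /lefP/(_ x) := nd_nnsfun_approx measurableT mf mn.
apply: congr_lim; apply/funext => n /=.
exact: integral_N01_nnsfun.
Qed.

Lemma integral_N01 (f : R -> R) : measurable_fun setT f ->
  (\int[N01]_x (f x)%:E = \int[mu]_x (f x * phi x)%:E)%E.
Proof.
move=> mf; have mfE : measurable_fun setT (EFin \o f) by exact/measurable_EFinP.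
have pos (a b : R) : 0 <= b -> (maxe (a * b)%:E 0 = maxe a%:E 0 * b%:E)%E.
  by move=> b0; rewrite -!EFin_max -EFinM maxr_pMl // mul0r.
rewrite integralE [RHS]integralE; congr (_ - _)%E.
- rewrite ge0_integral_N01; last by [].
    by apply: eq_integral => x _; rewrite !funeposE /= pos ?normal_pdf_ge0.
  exact: measurable_funepos.
- rewrite ge0_integral_N01; last by [].
    apply: eq_integral => x _; rewrite !funenegE.
    rewrite -[(- (f x * phi x)%:E)%E]/((- (f x * phi x))%:E).
    by rewrite -mulNr pos ?normal_pdf_ge0.
  exact: measurable_funeneg.
Qed.

(* [t <= exp t] at [t = x ^ 2 / 4]: the factor [x ^ 2] is absorbed by half of the
   exponent, leaving a normal density of variance 2. *)
Lemma phi_sqr_le : exists2 c : R, 0 <= c &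
  forall x, x ^+ 2 * phi x <= c * normal_pdf 0 (Num.sqrt 2) x.
Proof.
have s0 : Num.sqrt 2 != 0 :> R by rewrite sqrtr_eq0 -ltNge ltr0n.
have ps0 := normal_peak_gt0 s0.
exists (4 * normal_peak 1 / normal_peak (Num.sqrt 2)).
  by rewrite divr_ge0 ?mulr_ge0 ?normal_peak_ge0.
move=> x; rewrite phiE normal_pdfE // /normal_fun subr0 sqr_sqrtr ?ler0n //.
have -> : - x ^+ 2 / 2 = - x ^+ 2 / (2 *+ 2) + - (x ^+ 2 / 4) by field.
rewrite expRD expRN [leRHS]mulrA divfK ?gt_eqF //.
set e := expR (x ^+ 2 / 4); set E := expR _; set c := normal_peak _.
have e0 : 0 < e by exact: expR_gt0.
have xe : x ^+ 2 / 4 <= e by rewrite (le_trans _ (expR_ge1Dx _)) // lerDr.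
have -> : x ^+ 2 * (c * (E / e)) = (x ^+ 2 / 4) / e * (4 * c * E).
  by field; rewrite gt_eqF.
rewrite ler_piMl ?mulr_ge0 ?expR_ge0 ?normal_peak_ge0 //.
by rewrite ler_pdivrMr // mul1r.
Qed.

Lemma N01_integrable_le (f : R -> R) (C : R) : measurable_fun setT f ->
  (forall x, `|f x| <= C * (1 + x ^+ 2)) -> N01.-integrable setT (EFin \o f).
Proof.
move=> mf fC; apply/integrableP; split; first exact/measurable_EFinP.
have C0 : 0 <= C by have := fC 0; rewrite expr0n /= addr0 mulr1; apply: le_trans.
rewrite -[X in (X < _)%E]/(\int[N01]_x (`|f x|)%:E)%E.
rewrite (@integral_N01 (fun x => `|f x|)); last exact: measurableT_comp.
have [c c0 phi_le] := phi_sqr_le.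
pose psi := normal_pdf (0 : R) (Num.sqrt 2).
pose g x := C * (phi x + c * psi x).
have intg : mu.-integrable setT (EFin \o g).
  have i1 : mu.-integrable setT (EFin \o phi) by exact: integrable_normal_pdf.
  have i2 : mu.-integrable setT (EFin \o psi) by exact: integrable_normal_pdf.
  exact: (integrableZl measurableT C (integrableD measurableT i1
    (integrableZl measurableT c i2))).
apply: le_lt_trans (integrable_lty measurableT intg).
apply: ge0_le_integral => //.
- by move=> x _; rewrite lee_fin mulr_ge0 ?normal_pdf_ge0.
- apply/measurable_EFinP; apply: measurable_funM; last exact: measurable_phi.
  exact: measurableT_comp.
- by apply: measurable_int intg.
move=> x _; rewrite lee_fin /g.
have := fC x; have := phi_le x; have := normal_pdf_ge0 0 1 x.
rewrite -/(psi x); move: (phi x) (c * _) => a b a0 xab fCx.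
rewrite (le_trans (ler_wpM2r a0 fCx)) // -mulrA ler_wpM2l //.
by rewrite mulrDl mul1r lerD2l.
Qed.

(** Since [phi] has derivative [- x * phi x], the integrand is the derivative of [f * phi]. *)
Lemma ftc_phi (f f' : R -> R) (k : R) : 0 < k ->
  (forall x : R, is_derive x 1 f (f' x)) -> continuous f' ->
  (\int[mu]_(x in `[(- k)%R, k]) ((f' x - x * f x) * phi x)%:E =
   (f k * phi k - f (- k) * phi (- k))%:E)%E.
Proof.
move=> k0 df cf'.
have dF (x : R) : is_derive x 1 (f * phi : R -> R) ((f' x - x * f x) * phi x).
  have H := is_deriveM (df x) (is_derive_phi x).
  apply: (is_derive_eq H); rewrite /GRing.scale /=; ring.
have cf : continuous f by move=> x; apply/differentiable_continuous/derivable1_diffP; exact: (@ex_derive _ _ _ _ _ _ _ (df x)).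
have cphi : continuous phi by apply: continuous_normal_pdf; rewrite oner_eq0.
have cF : continuous (f * phi) by move=> x; apply: continuousM; [exact: cf | exact: cphi].
rewrite (@continuous_FTC2 _ _ (f * phi)) //.
- by rewrite (lt_trans _ k0) // oppr_lt0.
- apply: continuous_subspaceT => x; apply: cvgM; last exact: cphi.
  apply: cvgB; first exact: cf'.
  by apply: cvgM; [exact: cvg_id | exact: cf].
- split.
  + by move=> x _; exact: (@ex_derive _ _ _ _ _ _ _ (dF x)).
  + by apply: cvg_at_right_filter; exact: cF.
  + by apply: cvg_at_left_filter; exact: cF.
- by move=> x _; rewrite derive1E; exact: (@derive_val _ _ _ _ _ _ _ (dF x)).
Qed.

(** Controls the boundary terms in the integration by parts. For |x| >= 1 one has 1 + |x| <= 2 |x|,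
    which gives the factor 2 in [D], and x^2 phi(x) is bounded by [phi_sqr_le]. *)
Lemma phi_linear_le (f : R -> R) (C : R) : (forall x, `|f x| <= C * (1 + `|x|)) ->
  exists2 D : R, 0 <= D & forall x, 1 <= `|x| -> `|f x * phi x| <= D / `|x|.
Proof.
move=> fC; have [c c0 phi_le] := phi_sqr_le.
have C0 : 0 <= C by have := fC 0; rewrite normr0 addr0 mulr1; apply: le_trans.
have s0 : Num.sqrt 2 != 0 :> R by rewrite sqrtr_eq0 -ltNge ltr0n.
have ps0 := normal_peak_ge0 (Num.sqrt 2 : R).
exists (2 * C * (c * normal_peak (Num.sqrt 2))).
  by rewrite !mulr_ge0.
move=> x x1; have x0 : 0 < `|x| by exact: lt_le_trans x1.
rewrite ler_pdivlMr // normrM (ger0_norm (normal_pdf_ge0 0 1 x)).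
have := le_trans (phi_le x) (ler_wpM2l c0 (normal_pdf_ub 0 x s0)).
rewrite -[X in X * _ <= _]real_normK ?num_real //.
have := normal_pdf_ge0 0 1 x; have := fC x.
move: (c * _) (phi x) x1 `|f x| => d a; move: `|x| => y y1 b by_ a0 yad.
have h1 : b * a * y <= C * (1 + y) * a * y.
  by rewrite ler_wpM2r ?ler_wpM2r // (le_trans _ y1).
apply: (le_trans h1); rewrite -!mulrA [leRHS]mulrCA ler_wpM2l //.
have : (1 + y) * (a * y) <= (y + y) * (a * y).
  by rewrite ler_wpM2r ?lerD2r // mulr_ge0 // (le_trans _ y1).
move=> /le_trans; apply; rewrite (_ : (y + y) * (a * y) = 2 * (y ^+ 2 * a)); last by ring.
by rewrite ler_wpM2l.
Qed.

Lemma stein (f f' : R -> R) (C : R) :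
  (forall x : R, is_derive x 1 f (f' x)) -> continuous f' ->
  (forall x, `|f x| <= C * (1 + `|x|)) -> (forall x, `|f' x| <= C) ->
  [/\ N01.-integrable setT (fun x => (x * f x)%:E),
     N01.-integrable setT (fun x => (f' x)%:E) &
   (\int[N01]_x (x * f x)%:E = \int[N01]_x (f' x)%:E)%E].
Proof.
move=> df cf' fC f'C.
have C0 : 0 <= C by apply: le_trans (f'C 0).
have cf : continuous f by move=> x; apply/differentiable_continuous/derivable1_diffP; exact: (@ex_derive _ _ _ _ _ _ _ (df x)).
have mf' : measurable_fun setT f' by exact: continuous_measurable_fun.
have mf : measurable_fun setT f by exact: continuous_measurable_fun.
have mxf : measurable_fun setT (fun x : R => x * f x) by apply: measurable_funM.
have i1 : N01.-integrable setT (fun x => (x * f x)%:E).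
  apply: (@N01_integrable_le _ (2 * C)) => // x.
  rewrite normrM; apply: (le_trans (ler_wpM2l (normr_ge0 x) (fC x))).
  rewrite -[X in _ <= _ * (1 + X)]real_normK ?num_real //.
  have := normr_ge0 x; move: `|x| => a a0.
  rewrite mulrCA (mulrC 2) -mulrA ler_wpM2l //.
  have := sqr_ge0 (a - 1); nra.
have i2 : N01.-integrable setT (fun x => (f' x)%:E).
  apply: (@N01_integrable_le _ C) => // x.
  by rewrite (le_trans (f'C x)) // ler_peMr // lerDl sqr_ge0.
split => //.
pose h x := f' x - x * f x.
have mh : measurable_fun setT h by apply: measurable_funB.
have ih : N01.-integrable setT (fun x => (h x)%:E).
  exact: (integrableB measurableT i2 i1).
suff : (\int[N01]_x (h x)%:E = 0)%E.
  have -> : (\int[N01]_x (h x)%:E = \int[N01]_x ((f' x)%:E - (x * f x)%:E))%E by [].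
  rewrite (integralB measurableT i2 i1).
  have F1 := integrable_fin_num measurableT i1.
  have F2 := integrable_fin_num measurableT i2.
  rewrite -(fineK F1) -(fineK F2) -EFinB => -[/eqP].
  by rewrite subr_eq0 => /eqP ->.
have bh : (\int[mu]_x `|(h x * phi x)%:E| < +oo)%E.
  have /integrableP[_] := ih.
  rewrite -[X in (X < _)%E -> _]/(\int[N01]_x (`|h x|)%:E)%E.
  rewrite (@integral_N01 (fun x => `|h x|)); last exact: measurableT_comp.
  apply: le_lt_trans; rewrite le_eqVlt; apply/orP; left; apply/eqP.
  by apply: eq_integral => x _; rewrite /= normrM (ger0_norm (normal_pdf_ge0 0 1 x)).
have mhphi : measurable_fun setT (fun x => (h x * phi x)%:E).
  by apply/measurable_EFinP; apply: measurable_funM => //; exact: measurable_phi.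
rewrite integral_N01 //.
(* The integral over the line is the limit of those over [K k], by domination; on [K k] only the
   boundary terms of [ftc_phi] remain, and they tend to 0. *)
pose K k := `[(- k.+1%:R)%R, k.+1%:R : R]%classic.
pose g k x := ((h x * phi x) * \1_(K k) x)%:E.
have cvg1 : (\int[mu]_x g k x @[k --> \oo] --> \int[mu]_x (h x * phi x)%:E)%E.
  have [] // := @dominated_convergence _ _ R mu setT measurableT g
    (fun x => (h x * phi x)%:E) (fun x => `|(h x * phi x)%:E|%E).
  - move=> k; apply/measurable_EFinP; apply: measurable_funM; first exact/measurable_EFinP.
    by apply: measurable_indic; rewrite /K; exact: measurable_itv.
  - apply: aeW => x _; apply: (cvg_near_cst).
    near=> k; rewrite /g indicE mem_set ?mulr1 //= /K /= in_itv /= -ler_norml.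
    near: k; exists (Num.truncn `|x|) => // k /= xk.
    by rewrite ltW // (lt_le_trans (truncnS_gt `|x|)) // ler_nat ltnS.
  - by apply/integrableP; split; [exact: measurableT_comp | under eq_integral do rewrite abse_id].
  - apply: aeW => x k _; rewrite /g EFinM abseM -[leRHS]mule1 lee_pmul //.
    by rewrite abse_EFin lee_fin indicE; case: (_ \in _); rewrite ?normr1 ?normr0.
have cvg2 : (\int[mu]_x g k x @[k --> \oo] --> (0 : R)%:E)%E.
  have [D D0 fD] := phi_linear_le fC.
  have kN0 k : (0 : R) < k.+1%:R by rewrite ltr0n.
  have -> : (fun k => \int[mu]_x g k x)%E =
      (fun k => (f k.+1%:R * phi k.+1%:R - f (- k.+1%:R) * phi (- k.+1%:R))%:E).
    apply/funext => k; rewrite -ftc_phi // [RHS]integral_mkcond.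
    apply: eq_integral => x _; rewrite patchE /g indicE.
    by case: ifP => // _; rewrite ?mulr1 ?mulr0.
  apply: cvg_EFin; first by apply: nearW.
  apply/cvgr0Pnorm_le => /= e e0; near=> k.
  rewrite (le_trans (ler_normB _ _)) //.
  have hx (x : R) : `|x| = k.+1%:R -> `|f x * phi x| <= e / 2.
    move=> xk; rewrite (le_trans (fD x _)) ?xk ?ler1n //.
    rewrite ler_pdivrMr // mulrC -ler_pdivrMr ?divr_gt0 //.
    near: k; exists (Num.truncn (D / (e / 2))) => // k /= Dk.
    by rewrite ltW // (lt_le_trans (truncnS_gt _)) // ler_nat ltnS.
  by rewrite [leRHS]splitr lerD // hx ?normrN // ger0_norm.
exact: cvg_unique cvg1 cvg2.
Unshelve. all: by end_near. Qed.

End gaussian_1d.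

(** * The regularized Gram matrix *)

Section regularized_gram.
Variable R : realType.

Definition fro n m (M : 'M[R]_(n, m)) : R := \sum_i \sum_j M i j ^+ 2.

Lemma fro_ge0 n m (M : 'M[R]_(n, m)) : 0 <= fro M.
Proof. by apply: sumr_ge0 => i _; apply: sumr_ge0 => j _; exact: sqr_ge0. Qed.

Lemma fro_tr n m (M : 'M[R]_(n, m)) : fro M = \tr (M *m M^T).
Proof.
by apply: eq_bigr => i _; rewrite mxE; apply: eq_bigr => j _; rewrite mxE expr2.
Qed.

Lemma fro_trmx n m (M : 'M[R]_(n, m)) : fro M^T = fro M.
Proof.
rewrite /fro exchange_big; apply: eq_bigr => i _; apply: eq_bigr => j _.
by rewrite mxE.
Qed.

Lemma fro_tr_mul n m (M : 'M[R]_(n, m)) : fro M = \tr (M^T *m M).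
Proof. by rewrite mxtrace_mulC fro_tr. Qed.

Lemma sqr_entry_le_fro n m (M : 'M[R]_(n, m)) i j : M i j ^+ 2 <= fro M.
Proof.
rewrite /fro (bigD1 i) //= (bigD1 j) //= -addrA lerDl addr_ge0 //.
  by apply: sumr_ge0 => *; exact: sqr_ge0.
by apply: sumr_ge0 => *; apply: sumr_ge0 => *; exact: sqr_ge0.
Qed.

Lemma fro_eq0 n m (M : 'M[R]_(n, m)) : fro M = 0 -> M = 0.
Proof.
move=> M0; apply/matrixP => i j; rewrite mxE; apply/eqP.
by rewrite -sqrf_eq0 eq_le sqr_ge0 -M0 sqr_entry_le_fro.
Qed.

Variables (n m : nat).
Implicit Types (A : 'M[R]_(n, m)) (e : R).

Definition gram e A : 'M[R]_m := A^T *m A + e%:M.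
Definition igram e A : 'M[R]_m := invmx (gram e A).

Lemma gram_sym e A : (gram e A)^T = gram e A.
Proof. by rewrite /gram linearD /= trmx_mul trmxK tr_scalar_mx. Qed.

Lemma igram_sym e A : (igram e A)^T = igram e A.
Proof. by rewrite /igram trmx_inv gram_sym. Qed.

Lemma gram_unit e A : 0 < e -> gram e A \in unitmx.
Proof.
move=> e0; rewrite -row_free_unit; apply: inj_row_free => v vG.
have : \tr (v *m gram e A *m v^T) = 0 by rewrite vG mul0mx mxtrace0.
rewrite /gram mulmxDr mulmxDl linearD /= mul_mx_scalar -scalemxAl linearZ /=.
have -> : v *m (A^T *m A) *m v^T = (v *m A^T) *m (v *m A^T)^T.
  by rewrite trmx_mul trmxK !mulmxA.
rewrite -!fro_tr => /eqP; rewrite paddr_eq0 ?fro_ge0 ?mulr_ge0 ?fro_ge0 ?ltW //.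
by move=> /andP[_]; rewrite mulf_eq0 gt_eqF //= => /eqP/fro_eq0.
Qed.

Section facts.
Variables (e : R) (A : 'M[R]_(n, m)).
Hypothesis e0 : 0 <= e.
Hypothesis Gu : gram e A \in unitmx.
Local Notation H := (igram e A).
Local Notation X := (A *m H).
Local Notation t := (\tr H).

(** This is H = H (A^T A + e) H. For e >= 0 it exhibits H as a sum of squares, hence positive
    semidefinite, without any spectral decomposition. *)
Lemma igram_split : H = X^T *m X + e *: (H *m H).
Proof.
have -> : X^T *m X = H *m (A^T *m A) *m H.
  by rewrite trmx_mul igram_sym !mulmxA.
have -> : A^T *m A = gram e A - e%:M by rewrite /gram addrK.
by rewrite mulmxBr mulVmx // mulmxBl mul1mx mul_mx_scalar -scalemxAl subrK.
Qed.

Lemma igram_quad_ge0 k (Y : 'M[R]_(k, m)) : 0 <= \tr (Y *m H *m Y^T).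
Proof.
rewrite [X in Y *m X]igram_split mulmxDr mulmxDl linearD /= addr_ge0 //.
  rewrite (_ : _ *m Y^T = (Y *m X^T) *m (Y *m X^T)^T); last first.
    by rewrite [(Y *m X^T)^T]trmx_mul trmxK !mulmxA.
  by rewrite -fro_tr fro_ge0.
rewrite -scalemxAr -scalemxAl linearZ /= mulr_ge0 //.
rewrite (_ : _ *m Y^T = (Y *m H) *m (Y *m H)^T); last first.
  by rewrite [(Y *m H)^T]trmx_mul igram_sym !mulmxA.
by rewrite -fro_tr fro_ge0.
Qed.

Lemma tr_igram : t = fro X + e * fro H.
Proof.
rewrite [in LHS]igram_split linearD linearZ /= -fro_tr_mul.
by rewrite (fro_tr (igram e A)) igram_sym.
Qed.

Lemma tr_igram_ge0 : 0 <= t.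
Proof. by rewrite tr_igram addr_ge0 ?mulr_ge0 ?fro_ge0. Qed.

(** Cyclicity gives tr (A^T A H), and A^T A is [gram e A] minus e. The matrix A H A^T is the
    regularized hat matrix; its trace is also the sum of the products A_ij X_ij. *)
Lemma tr_hat : \tr (X *m A^T) = m%:R - e * t.
Proof.
rewrite mxtrace_mulC mulmxA.
have -> : A^T *m A = gram e A - e%:M by rewrite /gram addrK.
by rewrite mulmxBl mulmxV // linearB /= mxtrace1 mul_scalar_mx linearZ.
Qed.

Lemma hat_diag_ge0 i : 0 <= (X *m A^T) i i.
Proof.
have := igram_quad_ge0 (row i A).
rewrite tr_row -row_mul /mxtrace big_ord1 [X in 0 <= X -> _]mxE.
suff -> : \sum_j row i X 0 j * col i A^T j 0 = (X *m A^T) i i by [].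
by rewrite [RHS]mxE; apply: eq_bigr => k _; rewrite !mxE.
Qed.

Lemma tr_hat_ge0 : 0 <= \tr (X *m A^T).
Proof. exact: igram_quad_ge0. Qed.

Lemma tr_igram_le : e * t <= m%:R.
Proof. by rewrite -subr_ge0 -tr_hat tr_hat_ge0. Qed.

Lemma hat_diag_le i : (X *m A^T) i i <= m%:R.
Proof.
apply: (@le_trans _ _ (\tr (X *m A^T))).
  by rewrite /mxtrace (bigD1 i) //= lerDl sumr_ge0 // => k _; exact: hat_diag_ge0.
by rewrite tr_hat gerBl mulr_ge0 // tr_igram_ge0.
Qed.

Lemma fro_X_le : fro X <= t.
Proof. by rewrite tr_igram lerDl mulr_ge0 ?fro_ge0. Qed.

Lemma fro_H_le : e * fro H <= t.
Proof. by rewrite tr_igram lerDr fro_ge0. Qed.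

End facts.

Section limit.
Variables (e : R) (A : 'M[R]_(n, m)).
Hypothesis e0 : 0 < e.
Hypothesis Gu : gram 0 A \in unitmx.
Local Notation H := (igram e A).
Local Notation H0 := (igram 0 A).
Let Geu : gram e A \in unitmx := gram_unit A e0.

Lemma resolvent : H0 - H = e *: (H *m H0).
Proof.
have <- : H *m (gram e A - gram 0 A) *m H0 = e *: (H *m H0).
  have -> : gram e A - gram 0 A = e%:M.
    by rewrite /gram opprD addrACA subrr add0r raddf0 subr0.
  by rewrite mul_mx_scalar scalemxAl.
by rewrite mulmxBr mulVmx // mulmxBl mul1mx -mulmxA mulmxV // mulmx1.
Qed.

(** The gap is e tr (H H0). With H0 = X0^T X0, where X0 = A H0, it becomes e tr (X0 H X0^T). *)
Lemma tr_igram_le0 : \tr H <= \tr H0.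
Proof.
rewrite -subr_ge0 -linearB /= resolvent linearZ /= mulr_ge0 ?(ltW e0) //.
rewrite [X in H *m X](igram_split Gu) scale0r addr0 mulmxA mxtrace_mulC mulmxA.
exact: (igram_quad_ge0 (ltW e0) Geu).
Qed.

(** The left side is e tr (H H0), and tr (H0 H0) exceeds tr (H H0) by e tr (H0 H H0), which is
    nonnegative. *)
Lemma tr_igram_lipschitz : \tr H0 - \tr H <= e * fro H0.
Proof.
rewrite -linearB /= resolvent linearZ /= ler_pM2l //.
rewrite -subr_ge0 fro_tr igram_sym -linearB /= -mulmxBl resolvent.
rewrite -scalemxAl linearZ /= mulr_ge0 ?(ltW e0) // mxtrace_mulC mulmxA.
have := igram_quad_ge0 (ltW e0) Geu H0.
by rewrite igram_sym -mulmxA mxtrace_mulC.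
Qed.

End limit.
End regularized_gram.

(** * Differentiating the regularized pseudoinverse *)

Section continuous_mx.
Variable R : realType.

Definition continuous_mx n m (M : R -> 'M[R]_(n, m)) :=
  forall i j, continuous (fun z => M z i j).

Lemma continuous_sumr (I : Type) (s : seq I) (F : I -> R -> R) :
  (forall i, continuous (F i)) -> continuous (fun z => \sum_(i <- s) F i z).
Proof.
move=> cF; elim: s => [|a s IH] x.
  by under eq_fun do rewrite big_nil; exact: cvg_cst.
by under eq_fun do rewrite big_cons; apply: cvgD; [exact: cF | exact: IH].
Qed.

Lemma continuous_prodr (I : Type) (s : seq I) (F : I -> R -> R) :
  (forall i, continuous (F i)) -> continuous (fun z => \prod_(i <- s) F i z).
Proof.
move=> cF; elim: s => [|a s IH] x.
  by under eq_fun do rewrite big_nil; exact: cvg_cst.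
by under eq_fun do rewrite big_cons; apply: cvgM; [exact: cF | exact: IH].
Qed.

Lemma continuous_det n (M : R -> 'M[R]_n) :
  continuous_mx M -> continuous (fun z => \det (M z)).
Proof.
move=> cM; apply: continuous_sumr => s x; apply: cvgM; first exact: cvg_cst.
by apply: continuous_prodr => i; exact: cM.
Qed.

Lemma continuous_invmx n (M : R -> 'M[R]_n) : (forall z, M z \in unitmx) ->
  continuous_mx M -> continuous_mx (fun z => invmx (M z)).
Proof.
move=> Mu cM i j.
rewrite [X in continuous X](_ : _ = fun z => (\det (M z))^-1 * cofactor (M z) j i).
  move=> x; apply: cvgM.
    apply: cvgV; last exact: continuous_det.
    by have := Mu x; rewrite unitmxE unitfE.
  apply: cvgM; first exact: cvg_cst.
  apply: continuous_det => k l.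
  by under eq_fun do rewrite !mxE; exact: cM.
by apply/funext => z; rewrite /invmx Mu !mxE.
Qed.

Lemma continuous_mulmx n m p (M : R -> 'M[R]_(n, m)) (N : R -> 'M[R]_(m, p)) :
  continuous_mx M -> continuous_mx N -> continuous_mx (fun z => M z *m N z).
Proof.
move=> cM cN i j; under eq_fun do rewrite mxE.
by apply: continuous_sumr => k x; apply: cvgM; [exact: cM | exact: cN].
Qed.

Lemma continuous_trmx n m (M : R -> 'M[R]_(n, m)) :
  continuous_mx M -> continuous_mx (fun z => (M z)^T).
Proof. by move=> cM i j; under eq_fun do rewrite mxE; exact: cM. Qed.

Lemma continuous_mx_upd n m k (M : 'M[R]_(n, m)) : continuous_mx (mx_upd k M).
Proof.
move=> i j x; under eq_fun do rewrite mxE.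
by case: ifP => _; [exact: cvg_id | exact: cvg_cst].
Qed.

Lemma continuous_igram n m e (M : R -> 'M[R]_(n, m)) : 0 < e ->
  continuous_mx M -> continuous_mx (fun z => igram e (M z)).
Proof.
move=> e0 cM; apply: continuous_invmx => [z|i j]; first exact: gram_unit.
under eq_fun do rewrite mxE.
move=> x; apply: cvgD; last exact: cvg_cst.
by apply: continuous_mulmx => //; exact: continuous_trmx.
Qed.

End continuous_mx.

(** * Measurability of matrix operations *)

Section measurable_mx.
Context (R : realType) d (T : measurableType d).

Definition measurable_mx n m (M : T -> 'M[R]_(n, m)) :=
  forall i j, measurable_fun setT (fun z => M z i j).

Lemma measurable_inv : measurable_fun setT (@GRing.inv R).
Proof.
(* Inversion is continuous only away from 0, so its value 0 at 0 is split off as a separate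
   branch. *)
rewrite (_ : @GRing.inv R = fun x => if x == 0 then 0 else x^-1); last first.
  by apply/funext => x; case: eqP => // ->; rewrite invr0.
apply: measurable_fun_if => //.
  by apply: measurable_fun_eqr.
have -> : [set: R] `&` (fun x : R => x == 0) @^-1` [set false] = ~` [set 0].
  by rewrite setTI; apply/seteqP; split => x /= /eqP //= /negbTE.
apply: open_continuous_measurable_fun.
  by apply: closed_openC; exact: closed_eq.
by move=> x; rewrite inE /= => /eqP; exact: inv_continuous.
Qed.

Lemma measurable_det n (M : T -> 'M[R]_n) :
  measurable_mx M -> measurable_fun setT (fun z => \det (M z)).
Proof.
move=> mM; apply: measurable_sum => s; apply: measurable_funM => //.
by apply: measurable_prod => i _; exact: mM.
Qed.

Lemma measurable_unitmx n (M : T -> 'M[R]_n) :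
  measurable_mx M -> measurable_fun setT (fun z => M z \in unitmx).
Proof.
move=> mM.
rewrite (_ : (fun z => _) = fun z => ~~ (\det (M z) == 0)); last first.
  by apply/funext => z; rewrite unitmxE unitfE.
apply: measurable_neg; apply: measurable_fun_eqr => //.
exact: measurable_det.
Qed.

Lemma measurable_invmx n (M : T -> 'M[R]_n) :
  measurable_mx M -> measurable_mx (fun z => invmx (M z)).
Proof.
move=> mM i j.
(* Cramer's formula covers the invertible matrices; on the others [invmx] returns its argument. *)
rewrite (_ : (fun z => _) = fun z => if M z \in unitmx then
    (\det (M z))^-1 * cofactor (M z) j i else M z i j); last first.
  by apply/funext => z; rewrite /invmx; case: ifP => // _; rewrite !mxE.
apply: measurable_fun_ifT; [exact: measurable_unitmx| |exact: mM].
apply: measurable_funM.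
  by apply: (measurableT_comp measurable_inv); exact: measurable_det.
apply: measurable_funM => //; apply: measurable_det => k l.
by under eq_fun do rewrite !mxE; exact: mM.
Qed.

Lemma measurable_mulmx n m p (M : T -> 'M[R]_(n, m)) (N : T -> 'M[R]_(m, p)) :
  measurable_mx M -> measurable_mx N -> measurable_mx (fun z => M z *m N z).
Proof.
move=> mM mN i j; under eq_fun do rewrite mxE.
by apply: measurable_sum => k; apply: measurable_funM.
Qed.

Lemma measurable_trmx n m (M : T -> 'M[R]_(n, m)) :
  measurable_mx M -> measurable_mx (fun z => (M z)^T).
Proof. by move=> mM i j; under eq_fun do rewrite mxE; exact: mM. Qed.

Lemma measurable_mxtrace n (M : T -> 'M[R]_n) :
  measurable_mx M -> measurable_fun setT (fun z => \tr (M z)).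
Proof. by move=> mM; apply: measurable_sum => i; exact: mM. Qed.

Lemma measurable_fro n m (M : T -> 'M[R]_(n, m)) :
  measurable_mx M -> measurable_fun setT (fun z => fro (M z)).
Proof.
move=> mM; apply: measurable_sum => i; apply: measurable_sum => j.
by apply: measurable_funX.
Qed.

Lemma measurable_gram n m e (M : T -> 'M[R]_(n, m)) :
  measurable_mx M -> measurable_mx (fun z => gram e (M z)).
Proof.
move=> mM i j; under eq_fun do rewrite mxE.
apply: measurable_funD => //.
by apply: measurable_mulmx => //; exact: measurable_trmx.
Qed.

Lemma measurable_igram n m e (M : T -> 'M[R]_(n, m)) :
  measurable_mx M -> measurable_mx (fun z => igram e (M z)).
Proof. by move=> mM; apply: measurable_invmx; exact: measurable_gram. Qed.

End measurable_mx.

Section stein_entry.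
Variables (R : realType) (n m : nat) (e : R).
Hypothesis e0 : 0 < e.
Implicit Types (A : 'M[R]_(n, m)).

Definition rpinv A : 'M[R]_(n, m) := A *m igram e A.

(** With E = [delta_mx i j], differentiating X = A H along E gives E H - X E^T X - X A^T E H; the
    three terms here are its entries (i, j). *)
Definition drpinv A i j : R :=
  igram e A j j - rpinv A i j ^+ 2 - (rpinv A *m A^T) i i * igram e A j j.

(** An exact finite-difference formula, from the resolvent identity. Through Caratheodory's
    criterion it reduces differentiability to continuity of the entries. *)
Lemma rpinv_upd_diff A (k : 'I_n * 'I_m) (y z : R) :
  let B := mx_upd k A y in let C := mx_upd k A z in
  rpinv B k.1 k.2 - rpinv C k.1 k.2 =
  (igram e C k.2 k.2 - rpinv B k.1 k.2 * rpinv C k.1 k.2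
     - (rpinv B *m B^T) k.1 k.1 * igram e C k.2 k.2) * (y - z).
Proof.
move=> B C; pose D : 'M[R]_(n, m) := delta_mx k.1 k.2.
have BC : B - C = (y - z) *: D.
  apply/matrixP => i j; rewrite !mxE.
  case: ((i, j) =P k) => [<- /=|ne]; first by rewrite !eqxx mulr1.
  rewrite subrr; case: (i =P k.1) => /= [ik|]; last by rewrite mulr0.
  case: (j =P k.2) => /= [jk|]; last by rewrite mulr0.
  by case: ne; rewrite ik jk -surjective_pairing.
have GBC : gram e B - gram e C = (y - z) *: (D^T *m C + B^T *m D).
  rewrite /gram opprD addrACA subrr addr0.
  (* The splitting is asymmetric on purpose: placed between [igram e B] and [igram e C] and
     multiplied by [B] on the left, it regroups into [rpinv B] and [rpinv C]. *)
  rewrite (_ : B^T *m B - C^T *m C = (B - C)^T *m C + B^T *m (B - C)); last first.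
    by rewrite linearB /= mulmxBl mulmxBr [RHS]addrC addrA subrK.
  by rewrite BC linearZ /= -scalemxAl -scalemxAr scalerDr.
have HBC : igram e B - igram e C = - (y - z) *: (igram e B *m (D^T *m C + B^T *m D) *m igram e C).
  rewrite scaleNr scalemxAl scalemxAr -GBC mulmxBr mulVmx ?gram_unit //.
  by rewrite mulmxBl mul1mx -mulmxA mulmxV ?gram_unit // mulmx1 opprB.
have XBC : rpinv B - rpinv C = (y - z) *:
   (D *m igram e C - rpinv B *m D^T *m rpinv C - rpinv B *m B^T *m D *m igram e C).
  rewrite {1 2}/rpinv.
  rewrite (_ : B *m _ - _ = (B - C) *m igram e C + B *m (igram e B - igram e C)); last first.
    by rewrite mulmxBl mulmxBr [RHS]addrC addrA subrK.
  rewrite BC HBC -scalemxAl -scalemxAr scaleNr -scalerBr; congr (_ *: _).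
  rewrite /rpinv -addrA -opprD; congr (_ - _).
  by rewrite mulmxDr mulmxDl mulmxDr !mulmxA.
rewrite (_ : _ - _ = (rpinv B - rpinv C) k.1 k.2); last by rewrite [RHS]mxE [X in _ = _ + X]mxE.
rewrite XBC mxE mulrC; congr (_ * _).
have DE p (M : 'M[R]_(m, p)) j : (D *m M) k.1 j = M k.2 j.
  by rewrite mxE (bigD1 k.2) //= mxE !eqxx mul1r big1 ?addr0 // => l lk;
     rewrite mxE eqxx (negbTE lk) mul0r.
have ED p (M : 'M[R]_(p, m)) i l : (M *m D^T) i l = M i k.2 * (l == k.1)%:R.
  rewrite mxE (bigD1 k.2) //= !mxE eqxx andbT big1 ?addr0 // => a ak.
  by rewrite !mxE (negbTE ak) andbF mulr0.
have ED' p (M : 'M[R]_(p, n)) i l : (M *m D) i l = M i k.1 * (l == k.2)%:R.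
  rewrite mxE (bigD1 k.1) //= !mxE eqxx big1 ?addr0 // => a ak.
  by rewrite !mxE (negbTE ak) mulr0.
rewrite mxE [X in X + _]mxE DE; congr (_ + _ + _).
  rewrite mxE; congr (- _); rewrite mxE (bigD1 k.1) //= ED eqxx mulr1 big1 ?addr0 //.
  by move=> l lk; rewrite ED (negbTE lk) mulr0 mul0r.
rewrite mxE; congr (- _); rewrite mxE (bigD1 k.2) //= ED' eqxx mulr1 big1 ?addr0 //.
by move=> l lk; rewrite ED' (negbTE lk) mulr0 mul0r.
Qed.

Let cH A k : continuous_mx (fun z => igram e (mx_upd k A z)).
Proof. by apply: continuous_igram => //; exact: continuous_mx_upd. Qed.

Let cX A k : continuous_mx (fun z => rpinv (mx_upd k A z)).
Proof. by apply: continuous_mulmx; [exact: continuous_mx_upd | exact: cH]. Qed.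

Let cP A k : continuous_mx (fun z => rpinv (mx_upd k A z) *m (mx_upd k A z)^T).
Proof.
by apply: continuous_mulmx; [exact: cX | apply: continuous_trmx; exact: continuous_mx_upd].
Qed.

Lemma continuous_drpinv A k : continuous (fun z => drpinv (mx_upd k A z) k.1 k.2).
Proof.
move=> x; apply: cvgB; last by apply: cvgM; [exact: cP | exact: cH].
apply: cvgB; first exact: cH.
by under eq_fun do rewrite expr2; apply: cvgM; exact: cX.
Qed.

Lemma is_derive_rpinv A k (z : R) :
  is_derive z 1 (fun y => rpinv (mx_upd k A y) k.1 k.2) (drpinv (mx_upd k A z) k.1 k.2).
Proof.
apply/is_derive1_caratheodory.
exists (fun y => igram e (mx_upd k A z) k.2 k.2 -
   rpinv (mx_upd k A y) k.1 k.2 * rpinv (mx_upd k A z) k.1 k.2 -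
   (rpinv (mx_upd k A y) *m (mx_upd k A y)^T) k.1 k.1 * igram e (mx_upd k A z) k.2 k.2).
split; last by rewrite /drpinv expr2.
- by move=> y; exact: rpinv_upd_diff.
- apply: cvgB; last by apply: cvgM; [exact: cP | exact: cvg_cst].
  apply: cvgB; first exact: cvg_cst.
  by apply: cvgM; [exact: cX | exact: cvg_cst].
Qed.

End stein_entry.

(** * Stein's identity for the Gram matrix *)

Section gauss_identity.
Variables (R : realType) (d : measure_display) (T : measurableType d).
Variables (Q : probability T R) (n m : nat) (A : T -> 'M[R]_(n, m)).
Hypothesis gA : gauss_mx Q A.
Local Notation N01 := (normal_prob (0 : R) 1).

Lemma measurable_id_mx : measurable_mx (fun M : mxT R n m => M : 'M[R]_(n, m)).
Proof. by move=> i j; exact: measurable_entry. Qed.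

Let mA : measurable_fun setT (A : T -> mxT R n m).
Proof. by apply: measurable_mxP; case: gA. Qed.

(** Resampling is available for nonnegative functions, while [F] and [G] are signed. Both are
    dominated by [V], so it is applied to F + V and G + V, and the finite integral of [V] is then
    removed. *)
Lemma gauss_mx_resample_eq (k : 'I_n * 'I_m) (F G : mxT R n m -> R) (C : R) :
  measurable_fun setT F -> measurable_fun setT G ->
  (forall M : 'M[R]_(n, m), `|F M| <= C * (1 + M k.1 k.2 ^+ 2)) ->
  (forall M : 'M[R]_(n, m), `|G M| <= C * (1 + M k.1 k.2 ^+ 2)) ->
  (forall M : 'M[R]_(n, m), (\int[N01]_z (F (mx_upd k M z))%:E =
     \int[N01]_z (G (mx_upd k M z))%:E)%E) ->
  [/\ Q.-integrable setT (fun w => (F (A w))%:E),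
      Q.-integrable setT (fun w => (G (A w))%:E) &
      (\int[Q]_w (F (A w))%:E = \int[Q]_w (G (A w))%:E)%E].
Proof.
move=> mF mG FC GC FG.
pose V (M : mxT R n m) := C * (1 + (M : 'M[R]_(n, m)) k.1 k.2 ^+ 2).
have mV : measurable_fun setT V.
  apply: measurable_funM => //; apply: measurable_funD => //.
  by apply: measurable_funX; exact: measurable_entry.
have V0 M : 0 <= V M by apply: le_trans (FC M).
have updk (M : 'M[R]_(n, m)) z : mx_upd k M z k.1 k.2 = z by rewrite mxE -surjective_pairing eqxx.
pose v (z : R) := C * (1 + z ^+ 2).
have mv : measurable_fun setT v.
  apply: measurable_funM => //; apply: measurable_funD => //.
have vN : N01.-integrable setT (EFin \o v).
  apply: (@N01_integrable_le _ _ C) => // z.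
  by rewrite ger0_norm // -(updk 0 z) V0.
have mcomp (f : mxT R n m -> R) : measurable_fun setT f -> measurable_fun setT (f \o A).
  by move=> mf; exact: measurableT_comp mA.
have VQ : Q.-integrable setT (fun w => (V (A w))%:E).
  apply/integrableP; split; first by apply/measurable_EFinP; exact: mcomp.
  under eq_integral do rewrite gee0_abs ?lee_fin ?V0 //.
  rewrite (gauss_mx_resample k gA (F := EFin \o V)) //; last exact/measurable_EFinP.
  rewrite (eq_integral (cst (\int[N01]_z (v z)%:E)%E)); last first.
    by move=> w _; apply: eq_integral => z _; rewrite /= /V updk.
  rewrite integral_cst // [X in (_ * X)%E]probability_setT mule1.
  exact: (integrable_lty measurableT vN).
have main (f : mxT R n m -> R) : measurable_fun setT f ->
  (forall M : 'M[R]_(n, m), `|f M| <= C * (1 + M k.1 k.2 ^+ 2)) ->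
  Q.-integrable setT (fun w => (f (A w))%:E) /\
  (\int[Q]_w (f (A w))%:E + \int[Q]_w (V (A w))%:E =
   \int[Q]_w (\int[N01]_z (f (mx_upd k (A w) z))%:E + \int[N01]_z (v z)%:E))%E.
  move=> mf fC.
  have fQ : Q.-integrable setT (fun w => (f (A w))%:E).
    apply: (le_integrable measurableT) VQ.
      by apply/measurable_EFinP; exact: mcomp.
    by move=> w _ /=; rewrite lee_fin (le_trans (fC _)) // ler_norm.
  split=> //.
  rewrite -(integralD measurableT fQ VQ).
  rewrite (gauss_mx_resample k gA (F := fun M => (f M + V M)%:E)).
  - apply: eq_integral => w _.
    have mup : measurable_fun setT (mx_upd k (A w) : R -> mxT R n m).
      apply: measurable_mxP => i j; under eq_fun do rewrite mxE.
      by case: ((i, j) == k); [exact: measurable_id | exact: measurable_cst].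
    have fN : N01.-integrable setT (fun z => (f (mx_upd k (A w) z))%:E).
      apply: (@N01_integrable_le _ _ C); first exact: (measurableT_comp mf mup).
      by move=> z; rewrite (le_trans (fC _)) // updk.
    rewrite -(integralD measurableT fN vN); apply: eq_integral => z _.
    by rewrite /V updk.
  - by apply/measurable_EFinP; exact: measurable_funD.
  - move=> M; rewrite lee_fin addrC -lerBlDr sub0r.
    by rewrite (le_trans _ (fC M)) // -normrN ler_norm.
have [FQ eF] := main F mF FC; have [GQ eG] := main G mG GC.
split => //.
have : (\int[Q]_w (F (A w))%:E + \int[Q]_w (V (A w))%:E =
        \int[Q]_w (G (A w))%:E + \int[Q]_w (V (A w))%:E)%E.
  by rewrite eF eG; apply: eq_integral => w _; rewrite FG.
have F1 := integrable_fin_num measurableT FQ.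
have F2 := integrable_fin_num measurableT GQ.
have F3 := integrable_fin_num measurableT VQ.
by rewrite -(fineK F1) -(fineK F2) -(fineK F3) -!EFinD => -[] /addIr ->.
Qed.

Variable e : R.
Hypothesis e0 : 0 < e.

Let mH : measurable_mx (fun M : mxT R n m => igram e M).
Proof. by apply: measurable_igram; exact: measurable_id_mx. Qed.

Let mX : measurable_mx (fun M : mxT R n m => rpinv e M).
Proof. by apply: measurable_mulmx => //; exact: measurable_id_mx. Qed.

Let mP : measurable_mx (fun M : mxT R n m => rpinv e M *m M^T).
Proof. by apply: measurable_mulmx => //; apply: measurable_trmx; exact: measurable_id_mx. Qed.

Let normr_le1D (a b : R) : a ^+ 2 <= b -> `|a| <= 1 + b.
Proof.
move=> ab; rewrite -[X in X <= _]real_normK ?num_real // in ab.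
by have := normr_ge0 a; move: ab (sqr_ge0 (`|a| - 1)); nra.
Qed.

(** From e tr H <= m, [tau] bounds tr H, hence also |X|^2; from e |H|^2 <= tr H, tau / e bounds
    |H|^2. Since |a| <= 1 + a^2, the first summand of [C] covers the terms H_jj and (X A^T)_ii H_jj,
    where (X A^T)_ii lies in [0, m], and the second covers X_ij and its square. *)
Let tau : R := m%:R / e.
Let C : R := (1 + m%:R) * (1 + tau / e) + (1 + tau).

Let tr_le (M : 'M[R]_(n, m)) : \tr (igram e M) <= tau.
Proof. by rewrite ler_pdivlMr // mulrC (tr_igram_le (ltW e0) (gram_unit M e0)). Qed.

Let X_le (M : 'M[R]_(n, m)) i j : rpinv e M i j ^+ 2 <= tau.
Proof.
apply: le_trans (tr_le M); apply: le_trans (fro_X_le (ltW e0) (gram_unit M e0)).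
exact: sqr_entry_le_fro.
Qed.

Let tau0 : 0 <= tau. Proof. by rewrite divr_ge0 // ltW. Qed.

Let X_bound (M : 'M[R]_(n, m)) i j : `|rpinv e M i j| <= C.
Proof.
apply: (le_trans (normr_le1D (X_le M i j))); rewrite lerDr mulr_ge0 ?addr_ge0 //.
by rewrite divr_ge0 // ltW.
Qed.

Let D_bound (M : 'M[R]_(n, m)) i j : `|drpinv e M i j| <= C.
Proof.
have Hj : `|igram e M j j| <= 1 + tau / e.
  apply: normr_le1D; apply: (le_trans (sqr_entry_le_fro _ _ _)).
  rewrite ler_pdivlMr // mulrC; apply: le_trans (tr_le M).
  exact: (fro_H_le (gram_unit M e0)).
have P0 := hat_diag_ge0 (ltW e0) (gram_unit M e0) i.
have P1 := hat_diag_le (ltW e0) (gram_unit M e0) i.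
have Xij := X_le M i j.
rewrite -/(rpinv e M) in P0 P1; rewrite /drpinv.
have X0 := sqr_ge0 (rpinv e M i j).
move: P0 P1 Xij X0 Hj (ler_norm (igram e M j j)) (ler_norm (- igram e M j j)).
rewrite normrN /C; set h := 1 + tau / e.
move: (_ i i) (_ ^+ 2) (igram e M j j) => p x2 a p0 pm x2t x20 ah an anN.
have pa : p * `|a| <= m%:R * h by rewrite ler_pM.
have pa1 : p * a <= p * `|a| by rewrite ler_wpM2l.
have pa2 : - (p * a) <= p * `|a| by rewrite -mulrN ler_wpM2l.
have h0 : 0 <= h by exact: le_trans ah.
rewrite mulrDl mul1r ler_norml.
by apply/andP; split; lra.
Qed.

(* The two sides are the sums over the entries of [A_ij X_ij] and of the partial
   derivatives of [X_ij] in [A_ij], for [X = rpinv e A]. *)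
Lemma gram_identity :
  (\int[Q]_w (m%:R - e * \tr (igram e (A w)))%:E =
   \int[Q]_w ((n%:R - m%:R - 1) * \tr (igram e (A w))
      + e * fro (igram e (A w)) + e * \tr (igram e (A w)) ^+ 2)%:E)%E.
Proof.
have entry k : [/\ Q.-integrable setT (fun w => (A w k.1 k.2 * rpinv e (A w) k.1 k.2)%:E),
   Q.-integrable setT (fun w => (drpinv e (A w) k.1 k.2)%:E) &
   (\int[Q]_w (A w k.1 k.2 * rpinv e (A w) k.1 k.2)%:E =
    \int[Q]_w (drpinv e (A w) k.1 k.2)%:E)%E].
  apply: (@gauss_mx_resample_eq k (fun M => M k.1 k.2 * rpinv e M k.1 k.2)
    (fun M => drpinv e M k.1 k.2) C).
  - by apply: measurable_funM; [exact: measurable_entry | exact: mX].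
  - apply: measurable_funB; last by apply: measurable_funM; [exact: mP | exact: mH].
    by apply: measurable_funB; [exact: mH | apply: measurable_funX; exact: mX].
  - move=> M; rewrite normrM mulrC; have CX := X_bound M k.1 k.2.
    rewrite (le_trans (ler_wpM2r (normr_ge0 _) CX)) // ler_wpM2l ?(le_trans _ CX) //.
    exact: normr_le1D.
  - move=> M; rewrite (le_trans (D_bound M _ _)) // ler_peMr ?lerDl ?sqr_ge0 //.
    exact: le_trans (X_bound M k.1 k.2).
  - move=> M; have C0 := le_trans (normr_ge0 _) (X_bound M k.1 k.2).
    have [] // := @stein R (fun z => rpinv e (mx_upd k M z) k.1 k.2)
      (fun z => drpinv e (mx_upd k M z) k.1 k.2) C.
    + by move=> z; exact: is_derive_rpinv.
    + exact: continuous_drpinv.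
    + by move=> z; rewrite (le_trans (X_bound _ _ _)) // ler_peMr // lerDl.
    move=> _ _ <-; apply: eq_integral => z _.
    by rewrite mxE -surjective_pairing eqxx.
transitivity (\int[Q]_w (\sum_(k : 'I_n * 'I_m) (A w k.1 k.2 * rpinv e (A w) k.1 k.2)%:E))%E.
  apply: eq_integral => w _; rewrite sumEFin; congr EFin.
  rewrite -(tr_hat (gram_unit _ e0)) -/(rpinv e (A w)).
  rewrite -(pair_bigA _ (fun i j => A w i j * rpinv e (A w) i j)) /=.
  apply: eq_bigr => i _; rewrite [LHS]mxE; apply: eq_bigr => j _.
  by rewrite [X in _ * X = _]mxE mulrC.
rewrite integral_sum //; last by move=> k; case: (entry k).
transitivity (\sum_(k : 'I_n * 'I_m) \int[Q]_w (drpinv e (A w) k.1 k.2)%:E)%E.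
  by apply: eq_bigr => k _; case: (entry k).
rewrite -integral_sum //; last by move=> k; case: (entry k).
apply: eq_integral => w _; rewrite sumEFin; congr EFin.
rewrite -(pair_bigA _ (fun i j => drpinv e (A w) i j)) /=.
set H := igram e (A w); set X := rpinv e (A w).
(* The derivatives sum to n t - |X|^2 - (m - e t) t; then |X|^2 = t - e |H|^2 brings in the
   coefficient n - m - 1. *)
have -> : \sum_i \sum_j drpinv e (A w) i j =
    \sum_(i < n) \sum_(j < m) H j j - fro X - \tr (X *m (A w)^T) * \tr H.
  rewrite /fro mulr_suml -!sumrB; apply: eq_bigr => i _.
  by rewrite mulr_sumr -!sumrB; apply: eq_bigr => j _.
rewrite (tr_hat (gram_unit _ e0)) sumr_const card_ord -/H -/(\tr H).
have := tr_igram (gram_unit (A w) e0); rewrite -/H -/(rpinv e (A w)) -/X.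
move: (\tr H) (fro H) (fro X) => t s x tE.
have -> : x = t - e * s by rewrite tE addrK.
by rewrite -mulr_natl; ring.
Qed.

End gauss_identity.

(** * Expected trace of the inverse Gram matrix *)

Section null_sets.
Context d (T : measurableType d) (R : realType) (mu : {measure set T -> \bar R}).
Import HBNNSimple.

Let ge0_le_integral_nonmeasurable (f g : T -> \bar R) :
  (forall w, 0 <= f w)%E -> (forall w, f w <= g w)%E ->
  (\int[mu]_w f w <= \int[mu]_w g w)%E.
Proof.
move=> f0 fg; have g0 w : (0 <= g w)%E by exact: le_trans (fg w).
rewrite !ge0_integralTE //; apply: le_ereal_sup => _ [h /= hf <-].
by exists h => //= w; exact: le_trans (fg w).
Qed.

(* No measurability of [f] is required, so that junk values on a null set are harmless. *)
Lemma ge0_integral_eq_off_null (N : set T) (f g : T -> \bar R) :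
  measurable N -> mu N = 0%E -> measurable_fun setT g ->
  (forall w, 0 <= f w)%E -> (forall w, 0 <= g w)%E ->
  (forall w, ~ N w -> f w = g w) ->
  (\int[mu]_w f w = \int[mu]_w g w)%E.
Proof.
move=> mN muN mg f0 g0 fg.
have ind_ae (h : T -> \bar R) : measurable_fun setT h -> (forall w, 0 <= h w)%E ->
    (\int[mu]_w h w = \int[mu]_w (h \_ (~` N)) w)%E.
  move=> mh h0; apply: ge0_ae_eq_integral => //.
  - apply/(measurable_restrictT h (measurableC mN)).
    exact: measurable_funTS.
  - by move=> w _; rewrite patchE; case: ifP.
  - exists N; split => // w /=; apply: contra_notP => Nw _.
    by rewrite patchE mem_set.
have gN0 w : (0 <= (g \_ (~` N)) w)%E by rewrite patchE; case: ifP.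
apply/eqP; rewrite eq_le; apply/andP; split.
  (* The integral of [f] is a supremum over the simple functions below it. Each of them is
     measurable, so it can be cut to 0 on [N] without changing its integral, and is then below
     [g]. *)
  rewrite ge0_integralTE //; apply: ge_ereal_sup => _ [h /= hf <-].
  rewrite -integralT_nnsfun ind_ae; first last.
  - by move=> w; rewrite lee_fin.
  - by apply/measurable_EFinP; exact: measurable_funP.
  apply: ge0_le_integral_nonmeasurable => w; rewrite patchE; case: ifP => //.
    by move=> _; rewrite lee_fin.
  by rewrite inE => Nw; rewrite -fg.
rewrite ind_ae //; apply: ge0_le_integral_nonmeasurable => // w.
by rewrite patchE; case: ifP => // ; rewrite inE => Nw; rewrite fg.
Qed.

End null_sets.

(** * Almost sure invertibility of a Gaussian matrix *)

Section nonsingular.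
Variable R : realType.
Local Notation N01 := (normal_prob (0 : R) 1).

Lemma N01_set1 (x : R) : N01 [set x] = 0%E.
Proof.
have := @normal_prob_dominates R 0 1.
move=> /null_content_dominatesP; apply; first exact: measurable_set1.
exact: lebesgue_measure_set1.
Qed.

Lemma cofactor_upd n (M : 'M[R]_n.+1) (z : R) j :
  cofactor (mx_upd (ord0, ord0) M z) ord0 j = cofactor M ord0 j.
Proof.
rewrite /cofactor; congr (_ * \det _); apply/matrixP => a b; rewrite !mxE.
by rewrite xpair_eqE eq_sym (negbTE (neq_lift _ _)).
Qed.

Lemma det_upd n (M : 'M[R]_n.+1) (z : R) :
  \det (mx_upd (ord0, ord0) M z) =
  z * cofactor M ord0 ord0 + \sum_(j < n.+1 | j != ord0) M ord0 j * cofactor M ord0 j.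
Proof.
rewrite (expand_det_row _ ord0) (bigD1 ord0) //= mxE eqxx cofactor_upd; congr (_ + _).
by apply: eq_bigr => j j0; rewrite cofactor_upd mxE xpair_eqE (negbTE j0) andbF.
Qed.

Lemma measurable_det_eq0 d (T : measurableType d) n (A : T -> 'M[R]_n) :
  measurable_mx A -> measurable [set w | \det (A w) = 0].
Proof.
move=> mA; rewrite -[X in measurable X]setTI.
have := measurable_det mA measurableT (measurable_set1 0); exact.
Qed.

(** The determinant is affine in the corner entry, with the complementary minor as slope. By
    induction this slope is almost surely nonzero, and a resampled corner then hits the single root
    with probability 0. *)
Lemma gauss_det_neq0 n d (T : measurableType d) (Q : probability T R)
    (A : T -> 'M[R]_n) : gauss_mx Q A -> Q [set w | \det (A w) = 0] = 0%E.
Proof.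
elim: n A => [|n IH] A gA.
  rewrite [X in Q X](_ : _ = set0) ?measure0 //.
  by apply/seteqP; split => w //=; rewrite det_mx00 => /eqP; rewrite oner_eq0.
pose B w : 'M[R]_n := row' ord0 (col' ord0 (A w)).
have gB : gauss_mx Q B.
  pose f (k : 'I_n * 'I_n) := (lift ord0 k.1, lift ord0 k.2).
  have f_inj : injective f.
    by move=> [a b] [a' b'] /pair_equal_spec[/= /lift_inj -> /lift_inj ->].
  have := gauss_mx_reindex f_inj gA.
  rewrite (_ : (fun w => _) = B) //; apply/funext => w; apply/matrixP => i j.
  by rewrite !mxE.
have QB := IH _ gB.
pose F (M : mxT R n.+1 n.+1) : \bar R := (\1_[set N : 'M[R]_n.+1 | \det N = 0] M)%:E.
have mE : measurable ([set N : mxT R n.+1 n.+1 | \det (N : 'M[R]_n.+1) = 0]).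
  exact: (measurable_det_eq0 (@measurable_id_mx R n.+1 n.+1)).
have mF : measurable_fun setT F by apply/measurable_EFinP; exact: measurable_indic.
have mA : measurable_mx A by case: gA.
have -> : Q [set w | \det (A w) = 0] = (\int[Q]_w F (A w))%E.
  transitivity (\int[Q]_w (\1_[set w | \det (A w) = 0] w)%:E)%E.
    by rewrite integral_indic ?setIT //; exact: measurable_det_eq0.
  by apply: eq_integral => w _; rewrite /F !indicE.
rewrite (gauss_mx_resample (ord0, ord0) gA mF); last by move=> M; rewrite lee_fin.
have C0 w : cofactor (A w) ord0 ord0 = \det (B w) by rewrite /cofactor expr0 mul1r.
rewrite (@ge0_integral_eq_off_null _ _ _ Q [set w | \det (B w) = 0] _ (cst 0%E)) //.
- by rewrite integral0.
- by apply: measurable_det_eq0; case: gB.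
- by move=> w; apply: integral_ge0 => z _; rewrite lee_fin.
move=> w /= /eqP Bw.
pose D := \sum_(j < n.+1 | j != ord0) A w ord0 j * cofactor (A w) ord0 j.
have zE z : \det (mx_upd (ord0, ord0) (A w) z) = z * \det (B w) + D.
  by rewrite det_upd C0.
transitivity (\int[N01]_z (\1_[set - D / \det (B w)] z)%:E)%E.
  apply: eq_integral => z _; rewrite /F !indicE; congr (_ : bool)%:R%:E.
  apply/idP/idP; rewrite !inE /= zE => H; last by rewrite H divfK // addNr.
  by move/eqP: H; rewrite addr_eq0 => /eqP zB; rewrite -zB mulfK.
by rewrite integral_indic ?setIT //; exact: N01_set1.
Qed.

(** If v M^T M = 0 then |v M^T|^2 = 0, so v is also annihilated by the transpose of any square
    selection of rows of M. *)
Lemma unit_gram0 n m (M : 'M[R]_(n, m)) (f : 'I_m -> 'I_n) :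
  \det (rowsub f M) != 0 -> gram 0 M \in unitmx.
Proof.
move=> dM; rewrite -row_free_unit; apply: inj_row_free => v.
rewrite /gram raddf0 addr0 => vG.
have vM : v *m M^T = 0.
  apply: fro_eq0; rewrite fro_tr trmx_mul trmxK -mulmxA (mulmxA M^T) mulmxA vG.
  by rewrite mul0mx mxtrace0.
have vB : v *m (rowsub f M)^T = 0.
  apply/matrixP => i j; transitivity ((v *m M^T) i (f j)); last by rewrite vM !mxE.
  by rewrite mxE [RHS]mxE; apply: eq_bigr => k _; rewrite !mxE.
have Bu : (rowsub f M)^T \in unitmx by rewrite unitmx_tr unitmxE unitfE.
by rewrite -(mulmxK Bu v) vB mul0mx.
Qed.

End nonsingular.

(** * Letting the regularization tend to zero *)

Section limit.
Variables (R : realType) (d : measure_display) (T : measurableType d).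
Variables (Q : probability T R) (n m : nat) (A : T -> 'M[R]_(n, m)).

Lemma tr_igram0_ge0 (M : 'M[R]_(n, m)) : 0 <= \tr (igram 0 M).
Proof.
have [Mu|Mu] := boolP (gram 0 M \in unitmx); first exact: tr_igram_ge0.
(* In the singular case [invmx] returns the Gram matrix itself, whose trace is |M|^2. *)
rewrite /igram /invmx (negbTE Mu) /gram raddf0 addr0 -fro_tr_mul.
exact: fro_ge0.
Qed.

Lemma fro_igram_le0 (e : R) (M : 'M[R]_(n, m)) : 0 < e -> gram 0 M \in unitmx ->
  fro (igram e M) <= fro (igram 0 M).
Proof.
move=> e0 Mu; have Meu := gram_unit M e0.
set H := igram e M; set H0 := igram 0 M.
(* The two gaps are e tr (H H H0) and e tr (H H0 H0), both nonnegative. *)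
apply: (@le_trans _ _ (\tr (H *m H0))).
  rewrite -subr_ge0 fro_tr igram_sym -linearB /= -mulmxBr resolvent //.
  rewrite -scalemxAr linearZ /= mulr_ge0 ?(ltW e0) // mulmxA mxtrace_mulC mulmxA.
  rewrite mxtrace_mulC mulmxA.
  have := igram_quad_ge0 (lexx 0) Mu H.
  by rewrite igram_sym.
rewrite -subr_ge0 (fro_tr H0) igram_sym -linearB /= -mulmxBl resolvent //.
rewrite -scalemxAl linearZ /= mulr_ge0 ?(ltW e0) // mxtrace_mulC mulmxA.
have := igram_quad_ge0 (ltW e0) Meu H0.
by rewrite igram_sym -mulmxA mxtrace_mulC.
Qed.

Hypothesis gA : gauss_mx Q A.
Hypothesis Au : {ae Q, forall w, gram 0 (A w) \in unitmx}.

Let e_ (k : nat) : R := k.+1%:R^-1.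
Let e_gt0 k : 0 < e_ k. Proof. by rewrite invr_gt0 ltr0n. Qed.
Let e_cvg0 : e_ k @[k --> \oo] --> 0. Proof. exact: cvg_harmonic. Qed.

Let t0 w := \tr (igram 0 (A w)).
Let t_ k w := \tr (igram (e_ k) (A w)).
Let s_ k w := fro (igram (e_ k) (A w)).

Let mA : measurable_mx A. Proof. by case: gA. Qed.
Let mt0 : measurable_fun setT t0.
Proof. by apply: measurable_mxtrace; exact: measurable_igram. Qed.
Let mt_ k : measurable_fun setT (t_ k).
Proof. by apply: measurable_mxtrace; exact: measurable_igram. Qed.
Let ms_ k : measurable_fun setT (s_ k).
Proof. by apply: measurable_fro; exact: measurable_igram. Qed.

Let t_ge0 k w : 0 <= t_ k w.
Proof. by rewrite tr_igram_ge0 ?ltW //; exact: gram_unit. Qed.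
Let t0_ge0 w : 0 <= t0 w. Proof. exact: tr_igram0_ge0. Qed.
Let s_ge0 k w : 0 <= s_ k w. Proof. exact: fro_ge0. Qed.
Let et_le k w : e_ k * t_ k w <= m%:R.
Proof. by apply: tr_igram_le; [exact: ltW | exact: gram_unit]. Qed.
Let es_le k w : e_ k * s_ k w <= t_ k w.
Proof. by apply: fro_H_le; exact: gram_unit. Qed.

Let t_cvg w : gram 0 (A w) \in unitmx -> t_ k w @[k --> \oo] --> t0 w.
Proof.
move=> Mu; apply: (squeeze_cvgr (f := fun k => t0 w - e_ k * fro (igram 0 (A w))) (h := cst (t0 w))).
- apply: nearW => k; rewrite tr_igram_le0 // andbT lerBlDl -lerBlDr.
  exact: tr_igram_lipschitz.
- rewrite -[X in _ --> X]subr0; apply: cvgB; first exact: cvg_cst.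
  by rewrite -[X in _ --> X](mul0r (fro (igram 0 (A w)))); apply: cvgM => //; exact: cvg_cst.
- exact: cvg_cst.
Qed.

Let g_ k w := (n%:R - m%:R - 1) * t_ k w + e_ k * s_ k w + e_ k * t_ k w ^+ 2.

Let identity k : (\int[Q]_w (m%:R - e_ k * t_ k w)%:E = \int[Q]_w (g_ k w)%:E)%E.
Proof. exact: gram_identity. Qed.

Let lim_identity : Q.-integrable setT (EFin \o t0) ->
  (m%:R%:E = (n%:R - m%:R - 1)%:E * \int[Q]_w (t0 w)%:E)%E.
Proof.
move=> it0.
have c0 (c : R) : e_ k * c @[k --> \oo] --> 0.
  by rewrite -[X in _ --> X](mul0r c); apply: cvgM => //; exact: cvg_cst.
have cvg1 : (\int[Q]_w (m%:R - e_ k * t_ k w)%:E @[k --> \oo] --> m%:R%:E)%E.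
  rewrite [X in _ --> X](_ : _ = \int[Q]_w (cst m%:R%:E w))%E; last first.
    by rewrite integral_cst // [X in (_ * X)%E]probability_setT mule1.
  have [] // := @dominated_convergence _ _ R Q setT measurableT
    (fun k w => (m%:R - e_ k * t_ k w)%:E) (cst m%:R%:E) (cst m%:R%:E).
  - move=> k; apply/measurable_EFinP; apply: measurable_funB => //.
    by apply: measurable_funM.
  - move: Au; apply: filterS => w Mu _.
    apply: cvg_EFin; first exact: nearW.
    rewrite -[X in _ --> X]subr0; apply: cvgB; first exact: cvg_cst.
    by rewrite -[X in _ --> X](mul0r (t0 w)); apply: cvgM => //; exact: t_cvg.
  - exact: finite_measure_integrable_cst.
  - apply: aeW => w k _; rewrite lee_fin ger0_norm ?subr_ge0 //.
    by rewrite gerBl mulr_ge0 // ltW.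
have cvg2 : (\int[Q]_w (g_ k w)%:E @[k --> \oo] -->
     \int[Q]_w ((n%:R - m%:R - 1) * t0 w)%:E)%E.
  (* In the dominating factor, 1 comes from e s <= t and [m] from e t <= m, which bounds e t^2 by m
     t; finally t <= t0. *)
  have [] // := @dominated_convergence _ _ R Q setT measurableT
    (fun k w => (g_ k w)%:E) (fun w => ((n%:R - m%:R - 1) * t0 w)%:E)
    (fun w => ((`|n%:R - m%:R - 1| + 1 + m%:R) * t0 w)%:E).
  - move=> k; apply/measurable_EFinP; apply: measurable_funD.
      by apply: measurable_funD; apply: measurable_funM.
    by apply: measurable_funM => //; exact: measurable_funX.
  - by apply/measurable_EFinP; apply: measurable_funM.
  - move: Au; apply: filterS => w Mu _.
    apply: cvg_EFin; first exact: nearW.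
    have tc := t_cvg Mu.
    rewrite -[X in _ --> X]addr0; apply: cvgD.
      rewrite -[X in _ --> X]addr0; apply: cvgD; first by apply: cvgM => //; exact: cvg_cst.
      apply: (squeeze_cvgr (f := cst 0) (h := fun k => e_ k * fro (igram 0 (A w)))) => //.
      + apply: nearW => k; apply/andP; split; first by rewrite /= mulr_ge0 // ltW.
        by rewrite ler_wpM2l // ?fro_igram_le0 // ltW.
      + exact: cvg_cst.
    rewrite -[X in _ --> X](mul0r (t0 w ^+ 2)); apply: cvgM => //.
    by under eq_fun do rewrite expr2; rewrite expr2; apply: cvgM.
  - by under eq_fun do rewrite EFinM; apply: integrableZl.
  - move: Au; apply: filterS => w Mu k _; rewrite lee_fin /g_.
    have tt : t_ k w <= t0 w by exact: tr_igram_le0.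
    have := es_le k w; have := et_le k w; have := t_ge0 k w; have := s_ge0 k w.
    have := e_gt0 k; move: (n%:R - m%:R - 1) (e_ k) (s_ k w) (t_ k w) (t0 w) tt.
    move=> c e s t u tu e0 s0 tge etm est.
    rewrite (le_trans (ler_normD _ _)) // (le_trans (lerD (ler_normD _ _) (lexx _))) //.
    rewrite !mulrDl mul1r normrM (ger0_norm tge).
    rewrite (ger0_norm (mulr_ge0 (ltW e0) s0)) (ger0_norm (mulr_ge0 (ltW e0) (sqr_ge0 t))).
    rewrite !lerD //; first by rewrite ler_wpM2l.
      exact: le_trans tu.
    by rewrite expr2 mulrA ler_pM // mulr_ge0 // ltW.
move: cvg1; under eq_fun do rewrite identity.
move=> /(cvg_unique _ cvg2); move=> /(_ _) <- //.
by under eq_integral do rewrite EFinM; rewrite integralZl.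
Qed.

Let integrable_tr : (m.+1 < n)%N -> Q.-integrable setT (EFin \o t0).
Proof.
move=> mn; apply/integrableP; split; first exact/measurable_EFinP.
have c0 : 0 < n%:R - m%:R - 1 :> R.
  by rewrite -addrA -opprD subr_gt0 natr1 ltr_nat.
pose u w := gram 0 (A w) \in unitmx.
have mu : measurable_fun setT u by apply: measurable_unitmx; exact: measurable_gram.
pose f k w : \bar R := if u w then (t_ k w)%:E else 0%E.
have mf k : measurable_fun setT (f k).
  by apply: measurable_fun_ifT => //; exact/measurable_EFinP.
have f0 k w : (0 <= f k w)%E by rewrite /f; case: ifP => // _; rewrite lee_fin.
have -> : (\int[Q]_w `|(EFin \o t0) w| = \int[Q]_w limn_einf (f^~ w))%E.
  apply: ae_eq_integral => //.
  - by apply: measurableT_comp => //; exact/measurable_EFinP.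
  - by apply: measurableT_comp => //; apply: measurable_fun_limn_esup => k; exact: measurableT_comp.
  - move: Au; apply: filterS => w Mu _; rewrite /= ger0_norm //.
    rewrite /f /u Mu; apply/esym; apply: (cvg_limn_einf_sup _).1.
    by apply: cvg_EFin; [exact: nearW | exact: t_cvg].
apply: (@le_lt_trans _ _ (limn_einf (fun k => \int[Q]_w f k w))%E).
  exact: fatou.
apply: (@le_lt_trans _ _ (m%:R / (n%:R - m%:R - 1))%:E); last exact: ltry.
rewrite limn_einf_lim; apply: lime_le; first exact: is_cvg_einfs.
apply: nearW => k; apply: (@le_trans _ _ (\int[Q]_w f k w)%E).
  by apply: ereal_inf_lbound; exists k => /=.
(* Here n - m - 1 > 0 is decisive: [g_ k] is at least (n - m - 1) t, its other terms being
   nonnegative, while its integral equals that of m - e t and is at most m, uniformly in k. *)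
rewrite mulrC EFinM lee_pdivlMl //.
apply: (@le_trans _ _ (\int[Q]_w (g_ k w)%:E)%E).
  rewrite -ge0_integralZl //; first last.
  - by rewrite lee_fin ltW.
  apply: ge0_le_integral => //.
  - by move=> w _; rewrite mule_ge0 // lee_fin ltW.
  - exact: emeasurable_funM.
  - apply/measurable_EFinP; apply: measurable_funD.
      by apply: measurable_funD; apply: measurable_funM.
    by apply: measurable_funM => //; exact: measurable_funX.
  move=> w _; rewrite /f /g_.
  have es0 : 0 <= e_ k * s_ k w + e_ k * t_ k w ^+ 2.
    by rewrite addr_ge0 // mulr_ge0 ?sqr_ge0 // ltW.
  case: ifP => _; first by rewrite -EFinM lee_fin -[leRHS]addrA lerDl.
  by rewrite mule0 lee_fin -[leRHS]addrA addr_ge0 // mulr_ge0 // ltW.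
rewrite -identity (le_trans (@ge0_le_integral _ _ _ Q _ measurableT _ (cst m%:R%:E) _ _ _ _)) //.
- by move=> w _; rewrite lee_fin subr_ge0.
- by apply/measurable_EFinP; apply: measurable_funB => //; apply: measurable_funM.
- by move=> w _; rewrite lee_fin gerBl mulr_ge0 // ltW.
by rewrite integral_cst // [X in (_ * X)%E]probability_setT mule1.
Qed.

(** Positivity of [m] matters in the infinite case: the contradiction is m <= 0, and an empty Gram
    matrix does have expected trace 0. *)
Lemma tr_igram_expect : (0 < m)%N ->
  (\int[Q]_w (\tr (igram 0 (A w)))%:E =
   if (m.+1 < n)%N then (m%:R / (n%:R - m%:R - 1))%:E else +oo)%E.
Proof.
move=> m0; case: ifPn => mn.
  have it := integrable_tr mn; have := lim_identity it.
  have F := integrable_fin_num measurableT it.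
  rewrite -(fineK F) -EFinM => -[mE].
  have c0 : 0 < n%:R - m%:R - 1 :> R.
    by rewrite -addrA -opprD subr_gt0 natr1 ltr_nat.
  congr EFin; apply: (mulfI (lt0r_neq0 c0)).
  by rewrite -mE mulrCA divff ?mulr1 // lt0r_neq0.
apply/eqP; rewrite -leye_eq leNgt; apply/negP => tfin.
have it : Q.-integrable setT (EFin \o t0).
  apply/integrableP; split; first exact/measurable_EFinP.
  by under eq_integral do rewrite /= ger0_norm //.
have := lim_identity it; have F := integrable_fin_num measurableT it.
rewrite -(fineK F) -EFinM => -[] /eqP; apply/negP; rewrite gt_eqF //.
apply: (@le_lt_trans _ _ 0); last by rewrite ltr0n.
rewrite mulr_le0_ge0 //; last by apply: fine_ge0; apply: integral_ge0 => w _; rewrite lee_fin.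
by rewrite -addrA -opprD subr_le0 natr1 ler_nat leqNgt.
Qed.

End limit.

(** * The Moore-Penrose inverse *)

Section pseudoinverse.
Variable R : realType.

(** M X and M Y are symmetric and each absorbs the other, being orthogonal projectors onto the same
    range, so they coincide; likewise X M and Y M. *)
Lemma mp_pinv_spec_inj n m (M : 'M[R]_(n, m)) (X Y : 'M[R]_(m, n)) :
  mp_pinv_spec M X -> mp_pinv_spec M Y -> X = Y.
Proof.
move=> [mxm xmx mxT xmT] [mym ymy myT ymT].
have E1 : (M *m X) *m (M *m Y) = M *m Y by rewrite mulmxA mxm.
have E2 : (M *m Y) *m (M *m X) = M *m X by rewrite mulmxA mym.
have MXY : M *m X = M *m Y.
  by rewrite -[RHS]myT -E1 trmx_mul myT mxT E2.
have E3 : (X *m M) *m (Y *m M) = X *m M by rewrite -mulmxA (mulmxA M) mym.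
have E4 : (Y *m M) *m (X *m M) = Y *m M by rewrite -mulmxA (mulmxA M) mxm.
have XMY : X *m M = Y *m M.
  by rewrite -[LHS]xmT -E3 trmx_mul ymT xmT E4.
by rewrite -xmx -mulmxA MXY mulmxA XMY.
Qed.

Lemma mp_pinvE n m (M : 'M[R]_(n, m)) (X : 'M[R]_(m, n)) :
  mp_pinv_spec M X -> mp_pinv M = X.
Proof.
move=> MX; apply: (@mp_pinv_spec_inj _ _ M) => //.
have : [set Z | mp_pinv_spec M Z] X by [].
by move=> /xgetI; exact.
Qed.

Definition lpinv n m (M : 'M[R]_(n, m)) : 'M[R]_(m, n) := igram 0 M *m M^T.

Lemma gram0E n m (M : 'M[R]_(n, m)) : gram 0 M = M^T *m M.
Proof. by rewrite /gram raddf0 addr0. Qed.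

Lemma lpinv_mul n m (M : 'M[R]_(n, m)) : gram 0 M \in unitmx -> lpinv M *m M = 1%:M.
Proof. by move=> Mu; rewrite /lpinv -mulmxA -gram0E mulVmx. Qed.

Lemma fro_lpinv n m (M : 'M[R]_(n, m)) : gram 0 M \in unitmx ->
  fro (lpinv M) = \tr (igram 0 M).
Proof.
move=> Mu; rewrite fro_tr /lpinv trmx_mul trmxK igram_sym mulmxA -(mulmxA (igram 0 M)).
by rewrite -gram0E mulVmx // mul1mx.
Qed.

(** The identity includes singular [G], because [invmx] then leaves both [G] and its conjugate
    unchanged; hence the equivariance of [lpinv] at every matrix. *)
Lemma invmx_conj n (P G : 'M[R]_n) : P^T *m P = 1%:M ->
  invmx (P^T *m G *m P) = P^T *m invmx G *m P.
Proof.
move=> PP; have PP' := mulmx1C PP; have [PTu Pu] := mulmx1_unit PP.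
have [Gu|Gu] := boolP (G \in unitmx); last first.
  by rewrite /invmx !unitmx_mul PTu Pu (negbTE Gu).
have U : P^T *m G *m P \in unitmx by rewrite !unitmx_mul PTu Gu Pu.
have UY : (P^T *m G *m P) *m (P^T *m invmx G *m P) = 1%:M.
  by rewrite -!mulmxA (mulmxA P) PP' mul1mx (mulmxA G) mulmxV // mul1mx.
by rewrite -[RHS](mulKmx U) UY mulmx1.
Qed.

Lemma lpinv_orth n m (M : 'M[R]_(n, m)) (O : 'M[R]_n) (P : 'M[R]_m) :
  O^T *m O = 1%:M -> P^T *m P = 1%:M ->
  lpinv (O *m M *m P) = P^T *m lpinv M *m O^T.
Proof.
move=> OO PP; rewrite /lpinv /igram gram0E.
have -> : (O *m M *m P)^T *m (O *m M *m P) = P^T *m gram 0 M *m P.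
  rewrite gram0E !trmx_mul !mulmxA -(mulmxA _ O^T) OO mulmx1.
  by rewrite -!mulmxA.
rewrite invmx_conj // !trmx_mul !mulmxA -(mulmxA _ P) (mulmx1C PP) mulmx1.
by [].
Qed.

(* [invmx] of a singular matrix is the matrix itself, so [pinvw M] is a pseudoinverse
   only when [regular M]; it is nevertheless measurable and equivariant everywhere. *)
Definition pinvw n q (M : 'M[R]_(n, q)) : 'M[R]_(q, n) :=
  if (q <= n)%N then lpinv M else (lpinv M^T)^T.

Definition regular n q (M : 'M[R]_(n, q)) : bool :=
  if (q <= n)%N then gram 0 M \in unitmx else gram 0 M^T \in unitmx.

Lemma pinvw_orth n q (M : 'M[R]_(n, q)) (O : 'M[R]_n) (P : 'M[R]_q) :
  O^T *m O = 1%:M -> P^T *m P = 1%:M ->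
  pinvw (O *m M *m P) = P^T *m pinvw M *m O^T.
Proof.
move=> OO PP; rewrite /pinvw; case: ifP => _; first exact: lpinv_orth.
have -> : (O *m M *m P)^T = P^T *m M^T *m O^T by rewrite !trmx_mul mulmxA.
rewrite lpinv_orth ?trmxK ?(mulmx1C OO) ?(mulmx1C PP) //.
by rewrite !trmx_mul trmxK mulmxA.
Qed.

(** If q > n, M M^T is invertible. If q <= n, its pseudoinverse is M H H M^T with H = (M^T M)^-1,
    and M^T M H = 1 reduces the product to H M^T. *)
Lemma pinvwE n q (M : 'M[R]_(n, q)) : regular M ->
  M^T *m mp_pinv (M *m M^T) = pinvw M.
Proof.
rewrite /regular /pinvw; case: ifP => qn Mu; last first.
  have GE : M *m M^T = gram 0 M^T by rewrite gram0E trmxK.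
  rewrite GE (@mp_pinvE _ _ _ (igram 0 M^T)); last first.
    by split; rewrite /igram ?mulmxV ?mulVmx ?mul1mx ?trmx1.
  by rewrite /lpinv trmx_mul !trmxK igram_sym.
set H := igram 0 M.
have HT : H^T = H by exact: igram_sym.
have HM : H *m M^T *m M = 1%:M by exact: lpinv_mul.
have MH : M^T *m M *m H = 1%:M by rewrite -gram0E mulmxV.
have MTE k (Y : 'M[R]_(q, k)) : M^T *m (M *m (H *m Y)) = Y by rewrite !mulmxA MH mul1mx.
rewrite (@mp_pinvE _ _ _ (M *m H *m H *m M^T)).
  by rewrite /lpinv -!mulmxA MTE.
have E1 : M *m M^T *m (M *m H *m H *m M^T) = M *m H *m M^T.
  by rewrite -!mulmxA MTE !mulmxA.
have E2 : M *m H *m H *m M^T *m (M *m M^T) = M *m H *m M^T.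
  by rewrite -!mulmxA (mulmxA M^T M) (mulmxA H (M^T *m M)) (mulmxA H M^T) HM mul1mx !mulmxA.
have PT : (M *m H *m M^T)^T = M *m H *m M^T by rewrite !trmx_mul trmxK HT mulmxA.
split; rewrite ?E1 ?E2 //.
- by rewrite -!mulmxA (mulmxA H) (mulmxA (H *m M^T)) HM mul1mx.
- by rewrite -!mulmxA MTE.
Qed.

Lemma fro_pinvw n q (M : 'M[R]_(n, q)) : regular M ->
  fro (pinvw M) = if (q <= n)%N then \tr (igram 0 M) else \tr (igram 0 M^T).
Proof.
rewrite /regular /pinvw; case: ifP => _ Mu; first exact: fro_lpinv.
by rewrite fro_trmx fro_lpinv.
Qed.

(** The residual is the orthogonal projector onto the kernel of M: its squared norm is its trace,
    that is q minus the rank. *)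
Lemma fro_residual n q (M : 'M[R]_(n, q)) : regular M ->
  fro (1%:M - pinvw M *m M) = q%:R - (minn q n)%:R.
Proof.
rewrite /regular /pinvw; case: leqP => qn Mu.
  by rewrite lpinv_mul // !subrr /fro big1 // => i _; rewrite big1 // => j _; rewrite !mxE expr0n.
have LM : M *m (lpinv M^T)^T = 1%:M.
  by apply: trmx_inj; rewrite trmx_mul trmxK lpinv_mul // trmx1.
set W := (lpinv M^T)^T in LM *.
have WT : (W *m M)^T = W *m M.
  have -> : W = M^T *m igram 0 M^T by rewrite /W /lpinv trmxK trmx_mul igram_sym.
  by rewrite !trmx_mul trmxK igram_sym mulmxA.
rewrite fro_tr linearB /= trmx1 WT mulmxBl mul1mx mulmxBr mulmx1.
rewrite mulmxA -(mulmxA W) LM mulmx1 subrr subr0 linearB /= mxtrace1.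
by rewrite mxtrace_mulC LM mxtrace1.
Qed.

End pseudoinverse.

(** * Averaging over signs and permutations *)

Section quad.
Variable R : realType.

(** This is tr (L K L^T), the mean of |L u|^2 when u has second-moment matrix K. The expanded form
    displays the products that the sign flips act on. *)
Definition quad a b (K : 'M[R]_b) (L : 'M[R]_(a, b)) : R :=
  \sum_r \sum_k \sum_l L r k * L r l * K k l.

Definition colnorm a b (L : 'M[R]_(a, b)) k : R := \sum_r L r k ^+ 2.

Definition signmx b (s : 'I_b -> bool) : 'M[R]_b := diag_mx (\row_j (-1) ^+ s j).

Lemma colnorm_ge0 a b (L : 'M[R]_(a, b)) k : 0 <= colnorm L k.
Proof. by apply: sumr_ge0 => r _; exact: sqr_ge0. Qed.

Lemma fro_colnorm a b (L : 'M[R]_(a, b)) : fro L = \sum_k colnorm L k.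
Proof. exact: exchange_big. Qed.

Lemma quad_tr a b (K : 'M[R]_b) (L : 'M[R]_(a, b)) : quad K L = \tr (L *m K *m L^T).
Proof.
apply: eq_bigr => r _; rewrite mxE exchange_big; apply: eq_bigr => l _.
by rewrite !mxE mulr_suml; apply: eq_bigr => k _; rewrite mulrAC.
Qed.

Lemma quad_orth a b (K : 'M[R]_b) (L : 'M[R]_(a, b)) (O : 'M[R]_a) :
  O^T *m O = 1%:M -> quad K (O *m L) = quad K L.
Proof.
move=> OO; rewrite !quad_tr trmx_mul mulmxA mxtrace_mulC !mulmxA OO mul1mx.
by [].
Qed.

Lemma colnorm_orth a b (L : 'M[R]_(a, b)) (O : 'M[R]_a) k :
  O^T *m O = 1%:M -> colnorm (O *m L) k = colnorm L k.
Proof.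
move=> OO; have cE (M : 'M[R]_(a, b)) : colnorm M k = (M^T *m M) k k.
  by rewrite mxE; apply: eq_bigr => r _; rewrite mxE expr2.
by rewrite !cE trmx_mul mulmxA -(mulmxA _ _ O) OO mulmx1.
Qed.

Lemma signmx_orth b (s : 'I_b -> bool) : (signmx s)^T *m signmx s = 1%:M.
Proof.
rewrite tr_diag_mx mulmx_diag -diag_const_mx; congr diag_mx; apply/rowP => j.
by rewrite !mxE -expr2 sqrr_sign.
Qed.

Lemma mul_signmx a b (L : 'M[R]_(a, b)) s i j : (L *m signmx s) i j = L i j * (-1) ^+ s j.
Proof. by rewrite mul_mx_diag !mxE. Qed.

(** For k != l, flipping the sign at [k] alone is an involution that negates every term. *)
Lemma sum_signs b (k l : 'I_b) :
  \sum_(s : {ffun 'I_b -> bool}) (-1) ^+ s k * (-1) ^+ s l =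
  (k == l)%:R * #|{ffun 'I_b -> bool}|%:R :> R.
Proof.
case: eqP => [<-|/eqP kl].
  rewrite mul1r -sumr_const; apply: eq_bigr => s _; by rewrite -expr2 sqrr_sign.
rewrite mul0r; set x := LHS.
pose fl (s : {ffun 'I_b -> bool}) : {ffun 'I_b -> bool} :=
  [ffun i => if i == k then ~~ s i else s i].
have flK : involutive fl.
  by move=> s; apply/ffunP => i; rewrite !ffunE; case: eqP => // _; rewrite negbK.
have : x = - x.
  rewrite {1}/x (reindex_inj (inv_inj flK)) -sumrN; apply: eq_bigr => s _.
  rewrite !ffunE eqxx eq_sym (negbTE kl) -mulNr; congr (_ * _).
  by case: (s k); rewrite /= ?expr0 ?expr1 ?opprK.
by move/eqP; rewrite -subr_eq0 opprK -mulr2n mulrn_eq0 => /eqP.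
Qed.

Lemma quad_sign a b (K : 'M[R]_b) (L : 'M[R]_(a, b)) :
  \sum_(s : {ffun 'I_b -> bool}) quad K (L *m signmx s) =
  #|{ffun 'I_b -> bool}|%:R * \sum_k K k k * colnorm L k.
Proof.
rewrite mulr_sumr [RHS](eq_bigr (fun k => \sum_r L r k ^+ 2 * K k k * #|{ffun 'I_b -> bool}|%:R)).
  rewrite [RHS]exchange_big /=.
  rewrite [LHS]exchange_big /=; apply: eq_bigr => r _.
  rewrite [LHS]exchange_big /=; apply: eq_bigr => k _.
  rewrite exchange_big /= (bigD1 k) //= [X in _ + X]big1 ?addr0 => [|l lk].
    transitivity (\sum_(s : {ffun 'I_b -> bool}) L r k ^+ 2 * K k k * ((-1) ^+ s k * (-1) ^+ s k)).
      by apply: eq_bigr => s _; rewrite mul_signmx; ring.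
    by rewrite -mulr_sumr sum_signs eqxx mul1r.
  transitivity (\sum_(s : {ffun 'I_b -> bool}) L r k * L r l * K k l * ((-1) ^+ s k * (-1) ^+ s l)).
    by apply: eq_bigr => s _; rewrite !mul_signmx; ring.
  by rewrite -mulr_sumr sum_signs eq_sym (negbTE lk) mul0r mulr0.
move=> k _; rewrite /colnorm !mulr_sumr; apply: eq_bigr => r _; ring.
Qed.

End quad.

Lemma sume_const (R : realType) (I : finType) (c : \bar R) :
  (\sum_(i : I) c = #|I|%:R%:E * c)%E.
Proof.
rewrite (eq_bigr (fun=> 1%:E * c)%E); last by move=> i _; rewrite mul1e.
by rewrite -ge0_sume_distrl // sumEFin sumr_const.
Qed.

Section symmetrization.
Variables (R : realType) (d : measure_display) (T : measurableType d).
Variables (Q : probability T R) (n p : nat) (A : T -> 'M[R]_(n, p)).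
Hypothesis gA : gauss_mx Q A.
Variables (a b : nat) (F : mxT R n p -> 'M[R]_(a, b)).
Hypothesis mF : measurable_mx F.

Let mA : measurable_fun setT (A : T -> mxT R n p).
Proof. by apply: measurable_mxP; case: gA. Qed.

Let mquad (K : 'M[R]_b) : measurable_fun setT (fun M => quad K (F M)).
Proof.
apply: measurable_sum => r; apply: measurable_sum => k; apply: measurable_sum => l.
by apply: measurable_funM => //; apply: measurable_funM.
Qed.

Lemma measurable_colnorm k : measurable_fun setT (fun M => colnorm (F M) k).
Proof. by apply: measurable_sum => r; apply: measurable_funX. Qed.

(** A flip of the columns of [F] is realized by the flip [sg s] of the entries of [A], up to a left
    orthogonal factor, to which [quad] is blind. Nonnegativity of [quad] permits the exchange of sum
    and integral with no integrability assumption. *)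
Lemma quad_symmetrize (K : 'M[R]_b) (sg : {ffun 'I_b -> bool} -> 'I_n * 'I_p -> bool) :
  (forall L : 'M[R]_(a, b), 0 <= quad K L) ->
  (forall s (M : 'M[R]_(n, p)), exists2 O : 'M[R]_a, O^T *m O = 1%:M &
     F (\matrix_(i, j) ((-1) ^+ sg s (i, j) * M i j)) = O *m F M *m signmx R s) ->
  (\int[Q]_w (quad K (F (A w)))%:E =
   \int[Q]_w (\sum_k K k k * colnorm (F (A w)) k)%:E)%E.
Proof.
move=> K0 Fsg; set N : R := #|{ffun 'I_b -> bool}|%:R.
have N0 : 0 < N by rewrite ltr0n card_ffun expn_gt0 card_bool.
have quadS s w : quad K (F (\matrix_(i, j) ((-1) ^+ sg s (i, j) * A w i j))) =
    quad K (F (A w) *m signmx R s).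
  by have [U UU ->] := Fsg s (A w); rewrite -mulmxA quad_orth.
have inv_sign (s : {ffun _ -> bool}) : (\int[Q]_w (quad K (F (A w)))%:E =
    \int[Q]_w (quad K (F (A w) *m signmx R s))%:E)%E.
  rewrite (gauss_mx_law gA (gauss_mx_sign (sg s) gA) (F := fun M => (quad K (F M))%:E)).
  - by apply: eq_integral => w _; rewrite quadS.
  - exact/measurable_EFinP.
  - by move=> M; rewrite lee_fin.
transitivity (\int[Q]_w (N^-1%:E * \sum_(s : {ffun 'I_b -> bool})
    (quad K (F (A w) *m signmx R s))%:E))%E; last first.
  apply: eq_integral => w _; rewrite sumEFin quad_sign -EFinM mulrA mulVf ?mul1r //.
  by rewrite gt_eqF.
have mqs (s : {ffun 'I_b -> bool}) : measurable_fun setT (fun w => (quad K (F (A w) *m signmx R s))%:E).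
  rewrite (_ : (fun w => _) = fun w =>
    (quad K (F (\matrix_(i, j) ((-1) ^+ sg s (i, j) * A w i j))))%:E); last first.
    by apply/funext => w; rewrite quadS.
  apply/measurable_EFinP; apply: (measurableT_comp (mquad K)).
  by apply: measurable_mxP; case: (gauss_mx_sign (sg s) gA).
rewrite ge0_integralZl //; first last.
- by rewrite lee_fin invr_ge0 ltW.
- by move=> w _; apply: sume_ge0 => s _; rewrite lee_fin.
- exact: emeasurable_sum.
rewrite ge0_integral_sum //; last by move=> s w _; rewrite lee_fin.
rewrite (eq_bigr (fun=> \int[Q]_w (quad K (F (A w)))%:E)%E); last by move=> s _; rewrite -inv_sign.
by rewrite sume_const muleA -EFinM mulVf ?mul1e // gt_eqF.
Qed.

Lemma colnorm_exchangeable :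
  (forall k l, exists2 f : 'I_n * 'I_p -> 'I_n * 'I_p, injective f &
     forall M : 'M[R]_(n, p),
       colnorm (F (\matrix_(i, j) M (f (i, j)).1 (f (i, j)).2)) k = colnorm (F M) l) ->
  forall k, (b%:R%:E * \int[Q]_w (colnorm (F (A w)) k)%:E = \int[Q]_w (fro (F (A w)))%:E)%E.
Proof.
move=> Fex k.
have mc l : measurable_fun setT (fun w => (colnorm (F (A w)) l)%:E).
  by apply/measurable_EFinP; exact: (measurableT_comp (measurable_colnorm l) mA).
transitivity (\int[Q]_w (\sum_l (colnorm (F (A w)) l)%:E))%E; last first.
  by apply: eq_integral => w _; rewrite fro_colnorm sumEFin.
rewrite ge0_integral_sum //; last by move=> l w _; rewrite lee_fin colnorm_ge0.
rewrite (eq_bigr (fun=> \int[Q]_w (colnorm (F (A w)) k)%:E)%E).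
  by rewrite sume_const card_ord.
move=> l _; have [f f_inj Ff] := Fex k l.
rewrite [RHS](gauss_mx_law gA (gauss_mx_reindex f_inj gA) (F := fun M => (colnorm (F M) k)%:E)).
- by apply: eq_integral => w _; rewrite Ff.
- by apply/measurable_EFinP; exact: measurable_colnorm.
- by move=> M; rewrite lee_fin colnorm_ge0.
Qed.

End symmetrization.

(** * Expectations of pseudoinverses *)

(** Stein's identity for the identity function. *)
Lemma N01_second_moment (R : realType) :
  (\int[normal_prob (0 : R) 1]_z (z ^+ 2)%:E = 1)%E.
Proof.
have d1 (x : R) : is_derive x 1 (@id R) (cst 1 x) by exact: is_derive_id.
have c1 : continuous (cst 1 : R -> R) by move=> x; exact: cvg_cst.
have b1 (x : R) : `|id x| <= 1 * (1 + `|x|) by rewrite mul1r lerDr.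
have b2 (x : R) : `|cst 1 x| <= 1 :> R by rewrite normr1.
have [_ _ E] := stein d1 c1 b1 b2; rewrite [LHS]E.
by rewrite -[LHS]/(\int[normal_prob (0 : R) 1]_z (cst 1%:E z))%E integral_cst // [X in (_ * X)%E]probability_setT mule1.
Qed.

Lemma gammaS_ge0 (R : realType) q n : (0 <= @gammaS R q n)%E.
Proof.
rewrite /gammaS; case: ifPn => [qn|_].
  by rewrite lee_fin divr_ge0 // -addrA -opprD subr_ge0 natr1 ler_nat ltnW.
case: ifPn => [nq|_]; last exact: leey.
by rewrite lee_fin divr_ge0 // -addrA -opprD subr_ge0 natr1 ler_nat ltnW.
Qed.

Lemma measurable_pinvw (R : realType) d (T : measurableType d) n q
    (M : T -> 'M[R]_(n, q)) : measurable_mx M -> measurable_mx (fun w => pinvw (M w)).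
Proof.
move=> mM i j; rewrite /pinvw /lpinv; case: (q <= n)%N.
  by apply: measurable_mulmx; [exact: measurable_igram | exact: measurable_trmx].
apply: measurable_trmx; apply: measurable_mulmx.
  by apply: measurable_igram; exact: measurable_trmx.
by apply: measurable_trmx; exact: measurable_trmx.
Qed.

Lemma perm_mx_orth (R : realType) n (s : 'S_n) :
  (perm_mx s)^T *m perm_mx s = 1%:M :> 'M[R]_n.
Proof. by rewrite tr_perm_mx -perm_mxM mulVg perm_mx1. Qed.

Section gauss_pinv.
Variables (R : realType) (d : measure_display) (T : measurableType d).
Variable Q : probability T R.

Lemma gauss_mx_trmx n q (B : T -> 'M[R]_(n, q)) :
  gauss_mx Q B -> gauss_mx Q (fun w => (B w)^T).
Proof.
move=> gB; have f_inj : injective (fun k : 'I_q * 'I_n => (k.2, k.1)).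
  by move=> [a b] [a' b'] /pair_equal_spec[/= -> ->].
have := gauss_mx_reindex f_inj gB.
rewrite (_ : (fun w => _) = (fun w => (B w)^T)) //.
by apply/funext => w; apply/matrixP => i j; rewrite !mxE.
Qed.

Lemma gauss_gram_regular n q (B : T -> 'M[R]_(n, q)) : (q <= n)%N -> gauss_mx Q B ->
  exists N, [/\ measurable N, Q N = 0%E & forall w, ~ N w -> gram 0 (B w) \in unitmx].
Proof.
move=> qn gB; pose f := widen_ord qn.
have f_inj : injective (fun k : 'I_q * 'I_q => (f k.1, k.2)).
  move=> [a b] [a' b'] /pair_equal_spec[/= ff ->]; congr pair.
  by apply/val_inj; exact: (congr1 val ff).
have gC : gauss_mx Q (fun w => rowsub f (B w)) by exact: gauss_mx_reindex f_inj gB.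
exists [set w | \det (rowsub f (B w)) = 0]; split.
- by apply: measurable_det_eq0; case: gC.
- exact: gauss_det_neq0.
- by move=> w /= /eqP; exact: unit_gram0.
Qed.

Lemma gauss_regular n q (B : T -> 'M[R]_(n, q)) : gauss_mx Q B ->
  exists N, [/\ measurable N, Q N = 0%E & forall w, ~ N w -> regular (B w)].
Proof.
move=> gB; rewrite /regular; case: leqP => qn; first exact: gauss_gram_regular.
by apply: gauss_gram_regular (gauss_mx_trmx gB); exact: ltnW.
Qed.

Section expectations.
Variables (n q : nat) (B : T -> 'M[R]_(n, q)).
Hypotheses (n0 : (0 < n)%N) (q0 : (0 < q)%N) (gB : gauss_mx Q B).

Let mB : measurable_mx B. Proof. by case: gB. Qed.

Lemma expect_fro_pinvw : (\int[Q]_w (fro (pinvw (B w)))%:E = gammaS q n)%E.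
Proof.
have [N [mN QN BN]] := gauss_regular gB.
have aeN (P : T -> Prop) : (forall w, ~ N w -> P w) -> {ae Q, forall w, P w}.
  by move=> H; exists N; split => // w /=; apply: contra_notP; exact: H.
pose t w : R := if (q <= n)%N then \tr (igram 0 (B w)) else \tr (igram 0 (B w)^T).
have mt : measurable_fun setT t.
  rewrite /t; case: (q <= n)%N; apply: measurable_mxtrace; apply: measurable_igram => //.
  exact: measurable_trmx.
rewrite (ge0_integral_eq_off_null (g := EFin \o t) mN QN); first last.
- by move=> w Nw; rewrite fro_pinvw //; exact: BN.
- by move=> w; rewrite lee_fin /t; case: ifP => _; exact: tr_igram0_ge0.
- by move=> w; rewrite lee_fin fro_ge0.
- exact/measurable_EFinP.
(* For q <= n the second test of [gammaS] fails; for q > n the first one does, and the transposed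
   matrix has n columns, which exchanges the roles of n and q. *)
rewrite /gammaS /t; move: BN aeN; rewrite /regular; case: (leqP q n) => qn BN aeN.
  rewrite -[LHS]/(\int[Q]_w (\tr (igram 0 (B w)))%:E)%E.
  rewrite (tr_igram_expect gB) //; last exact: aeN.
  by case: ifP => // _; rewrite ltnNge (leq_trans qn) // leqnSn.
rewrite -[LHS]/(\int[Q]_w (\tr (igram 0 (B w)^T))%:E)%E.
rewrite (tr_igram_expect (gauss_mx_trmx gB)) //; last exact: aeN.
by rewrite [(q.+1 < n)%N]ltnNge (leq_trans (ltnW qn) (leqnSn _)).
Qed.

Lemma expect_colnorm_pinvw j :
  (\int[Q]_w (colnorm (pinvw (B w)) j)%:E = n%:R^-1%:E * gammaS q n)%E.
Proof.
rewrite -expect_fro_pinvw -(@colnorm_exchangeable _ _ _ Q n q B gB _ _ (@pinvw R n q) _ _ j).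
- by rewrite muleA -EFinM mulVf ?mul1e // pnatr_eq0 -lt0n.
- exact: (measurable_pinvw (@measurable_id_mx R n q)).
move=> k l; exists (fun x => (tperm k l x.1, x.2)).
  by move=> [a b] [a' b'] /pair_equal_spec[/= /perm_inj -> ->].
move=> M; rewrite (_ : \matrix_(i, j) _ = perm_mx (tperm k l) *m M *m 1%:M); last first.
  by rewrite mulmx1 -row_permE; apply/matrixP => a b; rewrite !mxE.
rewrite pinvw_orth ?perm_mx_orth ?trmx1 ?mulmx1 // mul1mx tr_perm_mx.
rewrite -col_permE; apply: eq_bigr => r _; by rewrite mxE tpermL.
Qed.

Lemma expect_colnorm_residual a :
  (\int[Q]_w (colnorm (1%:M - pinvw (B w) *m B w) a)%:E =
   (1 - (minn q n)%:R / q%:R)%:E)%E.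
Proof.
pose F (M : mxT R n q) : 'M[R]_q := 1%:M - pinvw M *m M.
have mF : measurable_mx F.
  move=> i j; under eq_fun do rewrite mxE.
  apply: measurable_funD => //; under eq_fun do rewrite mxE.
  apply: measurable_funN; apply: measurable_mulmx; last exact: measurable_id_mx.
  by apply: measurable_pinvw; exact: measurable_id_mx.
have q0' : q%:R != 0 :> R by rewrite pnatr_eq0 -lt0n.
have : (q%:R%:E * \int[Q]_w (colnorm (F (B w)) a)%:E = \int[Q]_w (fro (F (B w)))%:E)%E.
  apply: colnorm_exchangeable => // k l; exists (fun x => (x.1, tperm k l x.2)).
    by move=> [b c] [b' c'] /pair_equal_spec[/= -> /perm_inj ->].
  have colE m (M : 'M[R]_(m, q)) : M *m perm_mx (tperm k l) = col_perm (tperm k l) M.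
    by rewrite col_permE tpermV.
  move=> M; rewrite (_ : \matrix_(i, j) _ = 1%:M *m M *m perm_mx (tperm k l)); last first.
    by rewrite mul1mx colE; apply/matrixP => b c; rewrite !mxE.
  (* Permuting the columns of M conjugates the residual; the left factor is orthogonal and does not
     affect column norms. *)
  have -> : F (1%:M *m M *m perm_mx (tperm k l)) =
      (perm_mx (tperm k l))^T *m (F M *m perm_mx (tperm k l)).
    rewrite /F pinvw_orth ?perm_mx_orth ?trmx1 ?mulmx1 // mul1mx.
    by rewrite mulmxBl mulmxBr mul1mx perm_mx_orth !mulmxA.
  rewrite colnorm_orth; last by rewrite trmxK (mulmx1C (perm_mx_orth _ _)).
  by rewrite colE; apply: eq_bigr => r _; rewrite [X in X ^+ 2]mxE tpermL.
have -> : (\int[Q]_w (fro (F (B w)))%:E = (q%:R - (minn q n)%:R)%:E)%E.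
  have [N [mN QN BN]] := gauss_regular gB.
  rewrite (ge0_integral_eq_off_null (g := cst (q%:R - (minn q n)%:R)%:E) mN QN) //; first last.
  - by move=> w Nw; rewrite fro_residual //; exact: BN.
  - by move=> w; rewrite lee_fin subr_ge0 ler_nat geq_minl.
  - by move=> w; rewrite lee_fin fro_ge0.
  by rewrite integral_cst // [X in (_ * X)%E]probability_setT mule1.
move=> /(congr1 (fun x => (q%:R^-1)%:E * x)%E).
rewrite muleA -!EFinM mulVf // mul1e => ->.
by rewrite mulrBr mulVf // mulrC.
Qed.

End expectations.
End gauss_pinv.

(** * Second moments of linear images *)

Section second_moments.
Variables (R : realType) (d : measure_display) (T : measurableType d).
Variable P : probability T R.

Lemma integral_sqnorm b (u : T -> 'cV[R]_b) (K : 'M[R]_b) a (L : 'M[R]_(a, b)) :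
  (forall i, measurable_fun setT (fun t => u t i 0)) ->
  (forall i, P.-integrable setT (fun t => ((u t i 0) ^+ 2)%:E)) ->
  (forall i j, \int[P]_t (u t i 0 * u t j 0)%:E = (K i j)%:E)%E ->
  (\int[P]_t (sqnorm (L *m u t))%:E = (quad K L)%:E)%E.
Proof.
move=> mu iu uK.
have iuu i j : P.-integrable setT (fun t => (u t i 0 * u t j 0)%:E).
  apply: (le_integrable measurableT _ _ (integrableD measurableT (iu i) (iu j))).
    by apply/measurable_EFinP; exact: measurable_funM.
  move=> t _ /=; rewrite lee_fin [leRHS]ger0_norm ?addr_ge0 ?sqr_ge0 //.
  rewrite ler_norml; move: (u t i 0) (u t j 0) => x y.
  by have := sqr_ge0 (x + y); have := sqr_ge0 (x - y); have := sqr_ge0 x; have := sqr_ge0 y;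
     rewrite !expr2 => *; apply/andP; split; nra.
have icuu r i j : P.-integrable setT (fun t => ((L r i * L r j)%:E * (u t i 0 * u t j 0)%:E)%E).
  exact: integrableZl.
transitivity (\int[P]_t (\sum_r \sum_k \sum_l ((L r k * L r l)%:E * (u t k 0 * u t l 0)%:E)))%E.
  apply: eq_integral => t _; rewrite /sqnorm -sumEFin; apply: eq_bigr => r _.
  rewrite mxE expr2 mulr_suml -sumEFin; apply: eq_bigr => k _.
  rewrite mulr_sumr -sumEFin; apply: eq_bigr => l _.
  by rewrite -EFinM; congr EFin; ring.
have i2 r k : P.-integrable setT (fun t => \sum_l ((L r k * L r l)%:E * (u t k 0 * u t l 0)%:E))%E.
  exact: integrable_sum.
have i3 r : P.-integrable setT (fun t => \sum_k \sum_l ((L r k * L r l)%:E * (u t k 0 * u t l 0)%:E))%E.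
  exact: integrable_sum.
rewrite integral_sum // /quad -sumEFin; apply: eq_bigr => r _.
rewrite integral_sum // -sumEFin; apply: eq_bigr => k _.
rewrite integral_sum // -sumEFin; apply: eq_bigr => l _.
by rewrite integralZl // uK.
Qed.

(** The vectors are stacked into one, so that uncorrelatedness becomes the vanishing of the
    off-diagonal blocks of [K]. *)
Lemma integral_sqnorm_sub p n (x : T -> 'cV[R]_p) (v : T -> 'cV[R]_n) Kx Kv a
    (L : 'M[R]_(a, p)) (V : 'M[R]_(a, n)) :
  zero_mean_uncorrelated P x v Kx Kv ->
  (\int[P]_t (sqnorm (L *m x t - V *m v t))%:E = (quad Kx L + quad Kv V)%:E)%E.
Proof.
move=> [[mx mv ix iv] [_ _ xK vK xv0]].
pose u t := col_mx (x t) (v t).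
pose L' := row_mx L (- V).
pose K := block_mx Kx 0 0 Kv.
have -> : quad Kx L + quad Kv V = quad K L'.
  rewrite !quad_tr /L' /K mul_row_block !mulmx0 addr0 add0r tr_row_mx mul_row_col linearD /=.
  by rewrite linearN /= mulNmx mulmxN mulNmx opprK.
rewrite -(@integral_sqnorm _ u K).
- apply: eq_integral => t _; congr (sqnorm _)%:E.
  by rewrite /L' /u mul_row_col mulNmx.
- move=> i; rewrite -(splitK i) /u; case: (fintype.split i) => k /=.
    by under eq_fun do rewrite col_mxEu; exact: mx.
  by under eq_fun do rewrite col_mxEd; exact: mv.
- move=> i; rewrite -(splitK i) /u; case: (fintype.split i) => k /=.
    by under eq_fun do rewrite col_mxEu; exact: ix.
  by under eq_fun do rewrite col_mxEd; exact: iv.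
move=> i j; rewrite -(splitK i) -(splitK j) /u /K.
case: (fintype.split i) => k /=; case: (fintype.split j) => l /=.
- rewrite block_mxEul -xK; apply: eq_integral => t _; by rewrite !col_mxEu.
- rewrite block_mxEur mxE; apply: etrans (xv0 k l); apply: eq_integral => t _; by rewrite col_mxEu col_mxEd.
- rewrite block_mxEdl mxE; apply: etrans (xv0 l k); apply: eq_integral => t _.
  by rewrite col_mxEu col_mxEd mulrC.
- rewrite block_mxEdr -vK; apply: eq_integral => t _; by rewrite !col_mxEd.
Qed.

End second_moments.

(** * The error matrix *)

Section partial_estimator.
Variables (R : realType) (d : measure_display) (T : measurableType d).
Variables (Q : probability T R) (n p : nat) (S : {set 'I_p}) (A : T -> 'M[R]_(n, p)).
Hypotheses (n0 : (0 < n)%N) (S0 : (0 < #|S|)%N) (gA : gauss_mx Q A).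

Let B w : 'M[R]_(n, #|S|) := colsubS S (A w).

Lemma gauss_colsubS : gauss_mx Q B.
Proof.
have f_inj : injective (fun k : 'I_n * 'I_#|S| => (k.1, @idxS p S k.2)).
  by move=> [a b] [a' b'] /pair_equal_spec[/= -> /enum_val_inj ->].
exact: gauss_mx_reindex f_inj gA.
Qed.

Let mA : measurable_mx A. Proof. by case: gA. Qed.

Let mB0 : measurable_mx (fun M : mxT R n p => colsubS S (M : 'M[R]_(n, p))).
Proof. by move=> i j; under eq_fun do rewrite mxE; exact: measurable_entry. Qed.

Let mW0 : measurable_mx (fun M : mxT R n p => pinvw (colsubS S (M : 'M[R]_(n, p)))).
Proof. exact: measurable_pinvw. Qed.

(* Flipping the signs of the entries of a single column outside [S] leaves the
   estimator unchanged; averaging over these flips diagonalizes the square. *)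
Lemma expect_colnorm_cross k : k \notin S ->
  (\int[Q]_w (colnorm (pinvw (B w) *m A w) k)%:E = @gammaS R #|S| n)%E.
Proof.
move=> kS; have Sk i : @idxS p S i != k.
  by apply: contraNneq kS => <-; exact: enum_valP.
(* The row sums of [F] are the entries of column [k] of W A, so their squares add up to [quad] with
   the all-ones matrix [J]. Symmetrization then keeps only the unit diagonal of [J]. *)
pose F (M : mxT R n p) : 'M[R]_(#|S|, n) :=
  pinvw (colsubS S M) *m diag_mx (\row_j (M : 'M[R]_(n, p)) j k).
have FE M r j : F M r j = pinvw (colsubS S M) r j * (M : 'M[R]_(n, p)) j k.
  by rewrite /F mul_mx_diag !mxE.
have mF : measurable_mx F.
  move=> r j; under eq_fun do rewrite FE.
  by apply: measurable_funM; [exact: mW0 | exact: measurable_entry].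
pose J : 'M[R]_n := const_mx 1.
have quadJ a (L : 'M[R]_(a, n)) : quad J L = \sum_r (\sum_j L r j) ^+ 2.
  apply: eq_bigr => r _; rewrite expr2 mulr_suml; apply: eq_bigr => j _.
  by rewrite mulr_sumr; apply: eq_bigr => l _; rewrite mxE mulr1.
transitivity (\int[Q]_w (quad J (F (A w)))%:E)%E.
  apply: eq_integral => w _; rewrite quadJ; congr EFin; apply: eq_bigr => r _.
  by rewrite mxE; congr (_ ^+ 2); apply: eq_bigr => j _; rewrite FE.
rewrite (@quad_symmetrize _ _ _ Q n p A gA _ _ F mF J
  (fun s x => if x.2 == k then s x.1 else false)); first last.
- move=> s M; exists 1%:M; first by rewrite trmx1 mulmx1.
  rewrite mul1mx; apply/matrixP => r j; rewrite mul_signmx !FE !mxE eqxx.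
  rewrite -mulrA [_ * (-1) ^+ _]mulrC; congr (pinvw _ _ _ * _).
  by apply/matrixP => a b; rewrite !mxE /= (negbTE (Sk b)) expr0 mul1r.
- by move=> L; rewrite quadJ; apply: sumr_ge0 => r _; exact: sqr_ge0.
have colF w j : colnorm (F (A w)) j = colnorm (pinvw (B w)) j * A w j k ^+ 2.
  by rewrite /colnorm mulr_suml; apply: eq_bigr => r _; rewrite FE exprMn.
transitivity (\int[Q]_w \sum_j (colnorm (F (A w)) j)%:E)%E.
  by apply: eq_integral => w _; rewrite sumEFin; congr EFin; apply: eq_bigr => j _; rewrite mxE mul1r.
have mcF j : measurable_fun setT (fun M => (colnorm (F M) j)%:E).
  by apply/measurable_EFinP; exact: measurable_colnorm.
have mA' : measurable_fun setT (A : T -> mxT R n p) by exact: measurable_mxP.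
rewrite ge0_integral_sum //; first last.
- by move=> j w _; rewrite lee_fin colnorm_ge0.
- by move=> j; exact: (measurableT_comp (mcF j) mA').
rewrite -(expect_fro_pinvw n0 S0 gauss_colsubS).
transitivity (\int[Q]_w \sum_j (colnorm (pinvw (B w)) j)%:E)%E; last first.
  by apply: eq_integral => w _; rewrite fro_colnorm sumEFin.
have mW : measurable_mx (fun w => pinvw (B w)).
  by apply: measurable_pinvw => i j; under eq_fun do rewrite mxE; exact: mA.
rewrite ge0_integral_sum //; first last.
- by move=> j w _; rewrite lee_fin colnorm_ge0.
- by move=> j; apply/measurable_EFinP; apply: measurable_sum => r; apply: measurable_funX.
apply: eq_bigr => j _.
(* The entry (j, k) lies outside the columns of [B]: resampling it fixes the estimator and
   contributes the factor E z^2 = 1. *)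
rewrite (gauss_mx_resample (j, k) gA (mcF j)); last by move=> M; rewrite lee_fin colnorm_ge0.
apply: eq_integral => w _.
have updB z : colsubS S (mx_upd (j, k) (A w) z) = B w.
  by apply/matrixP => a b; rewrite !mxE xpair_eqE (negbTE (Sk b)) andbF.
transitivity (\int[normal_prob (0 : R) 1]_z
    ((colnorm (pinvw (B w)) j)%:E * (z ^+ 2)%:E))%E.
  apply: eq_integral => z _; rewrite -EFinM; congr EFin.
  rewrite /colnorm mulr_suml; apply: eq_bigr => r _.
  by rewrite FE updB mxE eqxx exprMn.
rewrite ge0_integralZl //.
- by rewrite N01_second_moment mule1.
- by apply/measurable_EFinP; exact: exprn_measurable.
- by move=> z _; rewrite lee_fin sqr_ge0.
- by rewrite lee_fin colnorm_ge0.
Qed.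

Definition error_mx (M : 'M[R]_(n, p)) : 'M[R]_(#|S|, p) :=
  rowsub (@idxS p S) 1%:M - pinvw (colsubS S M) *m M.

(** For k in S the column is one of the residual 1 - W A_S; outside S the selection matrix has a
    zero column and only W A contributes. *)
Lemma expect_colnorm_error k :
  (\int[Q]_w (colnorm (error_mx (A w)) k)%:E =
   if k \in S then (1 - (minn #|S| n)%:R / #|S|%:R)%:E else gammaS #|S| n)%E.
Proof.
case: ifPn => kS.
  rewrite -(expect_colnorm_residual S0 gauss_colsubS (enum_rank_in kS k)).
  apply: eq_integral => w _; congr EFin; apply: eq_bigr => r _; congr (_ ^+ 2).
  have kE : k = enum_val (enum_rank_in kS k) by rewrite enum_rankK_in.
  rewrite [LHS]mxE [RHS]mxE; congr (_ + _).
    by rewrite !mxE [in LHS]kE (inj_eq enum_val_inj).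
  rewrite [LHS]mxE [RHS]mxE; congr (- _); rewrite [LHS]mxE [RHS]mxE.
  by apply: eq_bigr => j _; congr (_ * _); rewrite mxE /idxS -kE.
rewrite -(expect_colnorm_cross kS).
apply: eq_integral => w _; congr EFin; apply: eq_bigr => r _.
rewrite [X in X ^+ 2]mxE [X in (X + _) ^+ 2]mxE [X in (X + _) ^+ 2]mxE.
rewrite (_ : (idxS r == k) = false) ?add0r; last first.
  by apply/negbTE; apply: contraNneq kS => <-; exact: enum_valP.
by rewrite [X in X ^+ 2]mxE sqrrN.
Qed.

Lemma measurable_error_mx : measurable_mx (fun M : mxT R n p => error_mx M).
Proof.
move=> i j; under eq_fun do rewrite mxE.
apply: measurable_funD; first by under eq_fun do rewrite mxE; exact: measurable_cst.
under eq_fun do rewrite mxE; apply: measurable_funN.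
by apply: measurable_mulmx => //; exact: measurable_id_mx.
Qed.

(** Flipping columns of A by signs D turns the error matrix E into D_S E D, where D_S restricts D to
    S: the estimator gains D_S on the left, and the selection matrix is preserved because signs
    square to 1. *)
Lemma expect_quad_error (K : 'M[R]_p) :
  (forall a (L : 'M[R]_(a, p)), 0 <= quad K L) ->
  (\int[Q]_w (quad K (error_mx (A w)))%:E =
   \int[Q]_w (\sum_k K k k * colnorm (error_mx (A w)) k)%:E)%E.
Proof.
move=> K0.
apply: (@quad_symmetrize _ _ _ Q n p A gA _ _ (fun M : mxT R n p => error_mx M)
  measurable_error_mx K (fun s x => s x.2)) => // s M.
pose sS i := s (@idxS p S i).
exists (signmx R sS); first exact: signmx_orth.
have -> : \matrix_(i, j) ((-1) ^+ s (i, j).2 * M i j) = M *m signmx R s.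
  by apply/matrixP => i j; rewrite mul_signmx !mxE mulrC.
have CE : colsubS S (M *m signmx R s) = 1%:M *m colsubS S M *m signmx R sS.
  by apply/matrixP => i j; rewrite mul1mx mul_signmx mxE mul_signmx mxE.
rewrite /error_mx CE pinvw_orth ?signmx_orth ?trmx1 ?mulmx1 //.
rewrite mulmxBr mulmxBl tr_diag_mx !mulmxA; congr (_ - _).
apply/matrixP => i j; rewrite mul_signmx mul_diag_mx !mxE.
case: eqP => [<-|_]; last by rewrite mulr0 mul0r.
by rewrite mulr1 -expr2 sqrr_sign.
Qed.

End partial_estimator.

(** * The expected error of the partial estimator *)

Theorem theorem1 (R : realType)
  (d : measure_display) (T : measurableType d) (P : probability T R)
  (d' : measure_display) (T' : measurableType d') (Q : probability T' R)
  (n p : nat) (S : {set 'I_p})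
  (x : T -> 'cV[R]_p) (v : T -> 'cV[R]_n) (Kx : 'M[R]_p) (Kv : 'M[R]_n)
  (A : T' -> 'M[R]_(n, p)) :
  (1 <= n)%N -> (1 <= #|S|)%N ->
  zero_mean_uncorrelated P x v Kx Kv ->
  iid_std_gaussian_mx Q A ->
  (\int[Q]_w (\int[P]_t
      (sqnorm (subvecS S (x t) - W_S S (A w) *m (A w *m x t + v t)))%:E))%E
  = ((\tr (covS S Kx) * (1 - (minn #|S| n)%:R / #|S|%:R))%:E
     + @gammaS R #|S| n * (\tr (covC S Kx) + n%:R^-1 * \tr Kv)%:E)%E.
Proof.
move=> n0 S0 zxv /gauss_mx_iid gA.
have gB := gauss_colsubS S gA.
pose B w : 'M[R]_(n, #|S|) := colsubS S (A w).
have mA : measurable_mx A by case: gA.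
have mB : measurable_mx B by case: gB.
have mW : measurable_mx (fun w => pinvw (B w)) by exact: measurable_pinvw.
have mE : measurable_mx (fun w => @error_mx R n p S (A w)).
  by move=> i j; have := measurableT_comp (measurable_error_mx (R := R) (n := n) (S := S) i j) (measurable_mxP mA).
have msum a b (K : 'M[R]_b) (L : T' -> 'M[R]_(a, b)) : measurable_mx L ->
    measurable_fun setT (fun w => (quad K (L w))%:E).
  move=> mL; apply/measurable_EFinP.
  apply: measurable_sum => r; apply: measurable_sum => k; apply: measurable_sum => l.
  by apply: measurable_funM => //; apply: measurable_funM.
have mcol a b (L : T' -> 'M[R]_(a, b)) k : measurable_mx L ->
    measurable_fun setT (fun w => (colnorm (L w) k)%:E).
  by move=> mL; apply/measurable_EFinP; apply: measurable_sum => r; apply: measurable_funX.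
(* Positivity of [Kx] comes from its being a matrix of second moments: the form is the mean of |L
   x|^2, obtained by giving [v] the coefficient 0. *)
have Kx0 a (L : 'M[R]_(a, p)) : 0 <= quad Kx L.
  rewrite -lee_fin; have := integral_sqnorm_sub L (0 : 'M[R]_(a, n)) zxv.
  rewrite [X in quad Kx L + X](_ : _ = 0); last first.
    by rewrite quad_tr !mul0mx mxtrace0.
  rewrite addr0 => <-; apply: integral_ge0 => t _; rewrite lee_fin.
  by apply: sumr_ge0 => i _; exact: sqr_ge0.
have Kv0 a (L : 'M[R]_(a, n)) : 0 <= quad Kv L.
  rewrite -lee_fin; have := integral_sqnorm_sub (0 : 'M[R]_(a, p)) L zxv.
  rewrite [X in X + quad Kv L](_ : _ = 0); last first.
    by rewrite quad_tr !mul0mx mxtrace0.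
  rewrite add0r => <-; apply: integral_ge0 => t _; rewrite lee_fin.
  by apply: sumr_ge0 => i _; exact: sqr_ge0.
have diag_ge0 b (K : 'M[R]_b) k :
    (forall a (L : 'M[R]_(a, b)), 0 <= quad K L) -> 0 <= K k k.
  move=> /(_ _ (delta_mx 0 k : 'rV_b)).
  rewrite quad_tr -rowE trmx_delta -colE /mxtrace big_ord1.
  by rewrite !mxE.
have weighted b (K : 'M[R]_b) a (L : T' -> 'M[R]_(a, b)) :
    (forall a (L : 'M[R]_(a, b)), 0 <= quad K L) -> measurable_mx L ->
    (\int[Q]_w (\sum_k K k k * colnorm (L w) k)%:E =
     \sum_k (K k k)%:E * \int[Q]_w (colnorm (L w) k)%:E)%E.
  move=> K0 mL; under eq_integral do rewrite -sumEFin.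
  have K0k k : 0 <= K k k by exact: diag_ge0.
  rewrite ge0_integral_sum //; first last.
  - by move=> k w _; rewrite lee_fin mulr_ge0 ?colnorm_ge0.
  - by move=> k; under eq_fun do rewrite EFinM; apply: emeasurable_funM => //; exact: mcol.
  apply: eq_bigr => k _; under eq_integral do rewrite EFinM.
  rewrite ge0_integralZl ?lee_fin //; first exact: mcol.
  by move=> w _; rewrite lee_fin colnorm_ge0.
have [N [mN QN BN]] := gauss_regular gB.
(* Off [N], [W_S] agrees with [pinvw] and the inner expectation is a sum of two quadratic forms. On
   [N] the integrands may differ, and only their nonnegativity is used. *)
transitivity (\int[Q]_w
    ((quad Kx (@error_mx R n p S (A w)))%:E + (quad Kv (pinvw (B w)))%:E))%E.
  apply: (ge0_integral_eq_off_null mN QN).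
  - by apply: emeasurable_funD; exact: msum.
  - move=> w; apply: integral_ge0 => t _; rewrite lee_fin.
    by apply: sumr_ge0 => i _; exact: sqr_ge0.
  - by move=> w; rewrite adde_ge0 // lee_fin.
  move=> w Nw.
  have WE : W_S S (A w) = pinvw (B w).
    by rewrite /W_S mul1mx mulmx1 addr0; apply: pinvwE; exact: BN.
  rewrite WE -EFinD -(integral_sqnorm_sub _ _ zxv); apply: eq_integral => t _.
  congr (sqnorm _)%:E; rewrite mulmxDr opprD addrA; congr (_ - _).
  rewrite mulmxBl mulmxA; congr (_ - _).
  by rewrite mul_rowsub_mx mul1mx.
rewrite ge0_integralD //; first last.
- exact: msum.
- by move=> w _; rewrite lee_fin.
- exact: msum.
- by move=> w _; rewrite lee_fin.
have g0 := @gammaS_ge0 R #|S| n; set g := gammaS #|S| n in g0 *.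
(* Flipping rows of [B] puts the same signs on the columns of [pinvw], so [Kv] enters through its
   diagonal; exchangeability of the rows gives each of the n columns the share g / n. *)
have -> : (\int[Q]_w (quad Kv (pinvw (B w)))%:E = g * (n%:R^-1 * \tr Kv)%:E)%E.
  rewrite (@quad_symmetrize _ _ _ Q n #|S| B gB _ _ (@pinvw R n #|S|) _ Kv
    (fun s k => s k.1)) //; first last.
  - move=> s M; exists 1%:M; first by rewrite trmx1 mulmx1.
    have -> : \matrix_(i, j) ((-1) ^+ s (i, j).1 * M i j) = signmx R s *m M *m 1%:M.
      by apply/matrixP => i j; rewrite mulmx1 mul_diag_mx !mxE.
    rewrite pinvw_orth ?signmx_orth ?trmx1 ?mulmx1 //.
    by rewrite tr_diag_mx.
  - exact: (measurable_pinvw (@measurable_id_mx R n #|S|)).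
  rewrite weighted //.
  rewrite (eq_bigr (fun k => (Kv k k)%:E * (n%:R^-1%:E * g)))%E; last first.
    by move=> k _; rewrite expect_colnorm_pinvw.
  rewrite -ge0_sume_distrl; last by move=> k _; rewrite lee_fin diag_ge0.
  by rewrite sumEFin -/(\tr Kv) muleA -EFinM muleC mulrC.
rewrite expect_quad_error // weighted //.
under eq_bigr do rewrite expect_colnorm_error //.
rewrite (bigID (mem S)) /=.
have -> : (\sum_(k in S) (Kx k k)%:E * (if k \in S then (1 - (minn #|S| n)%:R / #|S|%:R)%:E
    else gammaS #|S| n) = (\tr (covS S Kx) * (1 - (minn #|S| n)%:R / #|S|%:R))%:E)%E.
  rewrite (eq_bigr (fun k => (Kx k k * (1 - (minn #|S| n)%:R / #|S|%:R))%:E)); last first.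
    by move=> k ->; rewrite EFinM.
  rewrite sumEFin -mulr_suml big_enum_val; congr (_ * _)%:E.
  by apply: eq_bigr => i _; rewrite mxE.
have -> : (\sum_(k | k \notin S) (Kx k k)%:E * (if k \in S then (1 - (minn #|S| n)%:R / #|S|%:R)%:E
    else gammaS #|S| n) = g * (\tr (covC S Kx))%:E)%E.
  rewrite (eq_bigr (fun k => (Kx k k)%:E * g)%E); last by move=> k /negbTE ->.
  rewrite -ge0_sume_distrl; last by move=> k _; rewrite lee_fin diag_ge0.
  rewrite muleC sumEFin; congr (_ * _%:E)%E.
  rewrite (eq_bigl (fun k => k \in ~: S)); last by move=> k; rewrite inE.
  by rewrite big_enum_val; apply: eq_bigr => i _; rewrite mxE.
(* Since [g] may be [+oo], distributivity rests on both traces being nonnegative; if both vanish,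
   the convention that [+oo] times 0 is 0 applies. *)
rewrite -addeA -ge0_muleDr //.
- by rewrite lee_fin sumr_ge0 // => i _; rewrite mxE diag_ge0.
- by rewrite lee_fin mulr_ge0 // sumr_ge0 // => i _; rewrite diag_ge0.
Qed.
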